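(* Let a group $G$ act on a connected, locally finite graph $\Gamma$ of finite treewidth such that $G\backslash\Gamma$ is finite and the stabilizer $G_v$ of each vertex $v\in V(\Gamma)$ is finite. Then $G$ is (isomorphic to) the fundamental group of a finite graph of groups all of whose vertex groups are finite, and hence $G$ is virtually free.
   Context: The graph $\Gamma$ is undirected, simple (no loops, no multi-edges) and nonempty. A tree decomposition of $\Gamma$ is a tree $T$ with a map $t\mapsto X_t$ from $V(T)$ to finite subsets of $V(\Gamma)$ (bags) such that: every vertex of $\Gamma$ lies in some $X_t$; both endpoints of every edge of $\Gamma$ lie in a common $X_t$; and if $v\in X_s\cap X_t$ then $v\in X_r$ for all $r$ on the geodesic from $s$ to $t$ in $T$. $\Gamma$ has finite treewidth if it has a tree decomposition with $\sup_t|X_t|<\infty$. A graph of groups $\mathcal{G}$ over a connected undirected graph $Y$ (loops and multi-edges allowed; each edge $y$ has an inverse $\overline{y}\neq y$ with $s(y)=t(\overline{y})$, $\overline{\overline{y}}=y$) consists of a group $G_P$ for each vertex $P$, and for each edge $y$ a subgroup $G_y\le G_{s(y)}$ with an isomorphism $G_y\to G_{\overline{y}}$, $a\mapsto a^{\overline{y}}$, such that $(a^{\overline{y}})^{y}=a$. It is finite if $Y$ is finite. Its fundamental group $\pi_1(\mathcal{G})$ is, for a spanning tree $T$ of $Y$, the quotient of the free product of all $G_P$ and the free group on the edge set $E(Y)$ by the relations $\overline{y}y=1$ and $\overline{y}ay=a^{\overline{y}}$ ($y\in E(Y)$, $a\in G_y$) and $y=1$ for $y\in E(T)$; it does not depend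 on $T$ up to isomorphism. A group is called virtually free if it is finitely generated and has a free subgroup of finite index. *)

(* Defs.v *)
From HB Require Import structures.
From mathcomp Require Import all_boot generic_quotient finmap.
From mathcomp Require Import boolp classical_sets cardinality.

Set Implicit Arguments.
Unset Strict Implicit.
Unset Printing Implicit Defensive.

Local Open Scope group_scope.
Local Open Scope quotient_scope.
Local Open Scope classical_set_scope.

Record sgraph := SGraph {
  vertex :> choiceType;
  adj : rel vertex;
  adj_sym : symmetric adj;
  adj_irr : irreflexive adj
}.
Arguments adj {s} _ _.

Definition edges (Γ : sgraph) : set (set Γ) :=
  [set e | exists u v : Γ, adj u v /\ e = [set u; v]].
Arguments edges : clear implicits.

Definition connected_graph (Γ : sgraph) : Prop :=
  forall u v : Γ, exists2 p : seq Γ, path adj u p & last u p = v.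

Definition locally_finite (Γ : sgraph) : Prop :=
  forall v : Γ, finite_set [set w | adj v w].

Definition acyclic_graph (Γ : sgraph) : Prop :=
  forall c : seq Γ, 2 < size c -> uniq c -> ~~ cycle adj c.

Definition is_tree (T : sgraph) : Prop :=
  [/\ [set: T] !=set0, connected_graph T & acyclic_graph T].

(* [s :: p] lists the successive vertices of the geodesic. *)
Definition geodesic (Γ : sgraph) (s : Γ) (p : seq Γ) : Prop :=
  path adj s p /\
  forall q : seq Γ, path adj s q -> last s q = last s p -> size p <= size q.

Definition tree_decomposition (Γ T : sgraph) (X : T -> {fset Γ}) : Prop :=
  [/\ is_tree T,
      forall v : Γ, exists t : T, v \in X t,
      forall u v : Γ, adj u v -> exists t : T, u \in X t /\ v \in X t &
      forall (v : Γ) (s : T) (p : seq T), geodesic s p ->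
        v \in X s -> v \in X (last s p) ->
        forall r : T, r \in s :: p -> v \in X r].

Definition finite_treewidth (Γ : sgraph) : Prop :=
  exists (T : sgraph) (X : T -> {fset Γ}),
    tree_decomposition X /\ exists k : nat, forall t : T, #|` X t| <= k.

Record graph_action (G : groupType) (Γ : sgraph) := GraphAction {
  act :> G -> Γ -> Γ;
  act1 : forall v : Γ, act 1 v = v;
  actM : forall (g h : G) (v : Γ), act (g * h) v = act g (act h v);
  act_adj : forall (g : G) (u v : Γ), adj (act g u) (act g v) = adj u v
}.

Definition stabilizer G Γ (a : graph_action G Γ) (v : Γ) : set G :=
  [set g | a g v = v].

Definition vertex_orbit G Γ (a : graph_action G Γ) (v : Γ) : set Γ :=
  [set a g v | g in [set: G]].

Definition edge_orbit G Γ (a : graph_action G Γ) (e : set Γ) : set (set Γ) :=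
  [set a g @` e | g in [set: G]].

Definition finite_quotient_graph G Γ (a : graph_action G Γ) : Prop :=
  finite_set [set vertex_orbit a v | v in [set: Γ]] /\
  finite_set [set edge_orbit a e | e in edges Γ].

(* A letter (x, false) stands for x and (x, true) for its formal inverse. *)
Definition word (X : Type) := seq (X * bool).
Definition gen (X : Type) (x : X) : X * bool := (x, false).
Definition word_inv X (w : word X) : word X :=
  rev [seq (l.1, ~~ l.2) | l <- w].

Section Presentation.
Variables (X : choiceType) (R : word X -> word X -> Prop).

(* The congruence on words generated by free cancellation and the equations
   u = v for R u v. *)
Inductive pres_eq : word X -> word X -> Prop :=
| pres_refl u : pres_eq u u
| pres_sym u v : pres_eq u v -> pres_eq v u
| pres_trans u v w : pres_eq u v -> pres_eq v w -> pres_eq u w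
| pres_cat u u' v v' : pres_eq u u' -> pres_eq v v' ->
    pres_eq (u ++ v) (u' ++ v')
| pres_cancel x b : pres_eq [:: (x, b); (x, ~~ b)] [::]
| pres_rel u v : R u v -> pres_eq u v.

Definition pres_eqb (u v : word X) : bool := `[< pres_eq u v >].

Fact pres_eqb_refl : reflexive pres_eqb.
Proof. by move=> u; apply/asboolP; apply: pres_refl. Qed.
Fact pres_eqb_sym : symmetric pres_eqb.
Proof. by move=> u v; apply/asboolP/asboolP; apply: pres_sym. Qed.
Fact pres_eqb_trans : transitive pres_eqb.
Proof.
by move=> v u w /asboolP uv /asboolP vw; apply/asboolP; apply: pres_trans vw.
Qed.

Canonical pres_equiv :=
  EquivRel pres_eqb pres_eqb_refl pres_eqb_sym pres_eqb_trans.

Definition presented := {eq_quot pres_equiv}.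
HB.instance Definition _ := Choice.on presented.

Definition pres_class (w : word X) : presented := \pi_{eq_quot pres_equiv} w.

Lemma pres_classP (u v : word X) :
  reflect (pres_eq u v) (pres_class u == pres_class v).
Proof. by rewrite /pres_class eqmodE; apply: asboolP. Qed.

Lemma pres_class_repr (a : presented) : pres_class (repr a) = a.
Proof. exact: reprK. Qed.

Lemma repr_pres_class (w : word X) : pres_eq (repr (pres_class w)) w.
Proof. by apply/pres_classP/eqP; apply: pres_class_repr. Qed.

Lemma pres_cancel_inv (u : word X) : pres_eq (u ++ word_inv u) [::].
Proof.
elim: u => [|[x b] u IHu]; first exact: pres_refl.
rewrite /word_inv /= rev_cons -cats1 catA.
apply: pres_trans (pres_cancel x b).
rewrite -[X in pres_eq _ X]/([:: (x, b)] ++ [::] ++ [:: (x, ~~ b)]).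
rewrite -cat1s; apply: (pres_cat (u := [:: (x, b)])); first exact: pres_refl.
by apply: pres_cat; [apply: IHu | apply: pres_refl].
Qed.

Lemma word_invK : involutive (@word_inv X).
Proof.
move=> u; rewrite /word_inv map_rev revK -map_comp map_id_in // => -[x b] _.
by rewrite /= negbK.
Qed.

Lemma word_inv_cat (u v : word X) :
  word_inv (u ++ v) = word_inv v ++ word_inv u.
Proof. by rewrite /word_inv map_cat rev_cat. Qed.

Lemma pres_inv (u v : word X) : pres_eq u v ->
  pres_eq (word_inv u) (word_inv v).
Proof.
move=> uv; have inv_l w : pres_eq (word_inv w ++ w) [::].
  by rewrite -{2}[w]word_invK; apply: pres_cancel_inv.
apply: (@pres_trans _ (word_inv u ++ v ++ word_inv v)).
  rewrite -{1}[word_inv u]cats0; apply: pres_cat; first exact: pres_refl.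
  exact/pres_sym/pres_cancel_inv.
rewrite catA -[X in pres_eq _ X]cat0s; apply: pres_cat; last exact: pres_refl.
apply: pres_trans (inv_l u); apply: pres_cat; first exact: pres_refl.
exact: pres_sym.
Qed.

Definition pres_one : presented := pres_class [::].
Definition pres_mul (a b : presented) : presented :=
  pres_class (repr a ++ repr b).
Definition pres_invg (a : presented) : presented :=
  pres_class (word_inv (repr a)).

Lemma pres_mulE (u v : word X) :
  pres_mul (pres_class u) (pres_class v) = pres_class (u ++ v).
Proof. by apply/eqP/pres_classP/pres_cat; apply: repr_pres_class. Qed.

Lemma pres_invE (u : word X) :
  pres_invg (pres_class u) = pres_class (word_inv u).
Proof. exact/eqP/pres_classP/pres_inv/repr_pres_class. Qed.

Fact pres_mulA : associative pres_mul.
Proof.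
move=> a b c; rewrite -[a]pres_class_repr -[b]pres_class_repr.
by rewrite -[c]pres_class_repr !pres_mulE catA.
Qed.
Fact pres_mul1 : left_id pres_one pres_mul.
Proof. by move=> a; rewrite -[a]pres_class_repr pres_mulE. Qed.
Fact pres_mulr1 : right_id pres_one pres_mul.
Proof. by move=> a; rewrite -[a]pres_class_repr pres_mulE cats0. Qed.
Fact pres_mulV : left_inverse pres_one pres_invg pres_mul.
Proof.
move=> a; rewrite -[a]pres_class_repr pres_invE pres_mulE.
apply/eqP/pres_classP; rewrite -{2}[repr a]word_invK; exact: pres_cancel_inv.
Qed.
Fact pres_mulrV : right_inverse pres_one pres_invg pres_mul.
Proof.
move=> a; rewrite -[a]pres_class_repr pres_invE pres_mulE.
exact/eqP/pres_classP/pres_cancel_inv.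
Qed.

HB.instance Definition _ := isGroup.Build presented
  pres_mulA pres_mul1 pres_mulr1 pres_mulV pres_mulrV.

End Presentation.

Definition free_group (X : choiceType) : groupType :=
  presented (fun _ _ : word X => False).

Definition isomorphic (G H : groupType) : Prop :=
  exists f : {multiplicative G -> H}, bijective f.

Definition is_subgroup (G : groupType) (H : set G) : Prop :=
  group_closed (mem H).

Definition finitely_generated (G : groupType) : Prop :=
  exists2 S : set G, finite_set S &
    forall H : set G, is_subgroup H -> S `<=` H -> H = [set: G].

Definition finite_index (G : groupType) (H : set G) : Prop :=
  finite_set [set [set g * h | h in H] | g in [set: G]].

Definition is_free_subgroup (G : groupType) (H : set G) : Prop :=
  exists (X : choiceType) (f : {multiplicative free_group X -> G}),
    injective f /\ range f = H.

Definition virtually_free (G : groupType) : Prop :=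
  finitely_generated G /\
  exists H : set G, [/\ is_subgroup H, is_free_subgroup H & finite_index H].

(* Loops and multiple edges are allowed; an undirected edge is a pair
   {y, ybar y} of distinct oriented edges. *)
Record mgraph := MGraph {
  mvertex :> choiceType;
  medge : choiceType;
  src : medge -> mvertex;
  ebar : medge -> medge;
  ebarK : involutive ebar;
  ebar_neq : forall y, ebar y != y
}.
Arguments src {m} _.
Arguments ebar {m} _.

Definition tgt (Y : mgraph) (y : medge Y) : Y := src (ebar y).

Fixpoint walk (Y : mgraph) (P : Y) (p : seq (medge Y)) (Q : Y) : bool :=
  if p is y :: p' then (src y == P) && walk (tgt y) p' Q else P == Q.

Definition connected_by (Y : mgraph) (T : set (medge Y)) : Prop :=
  forall P Q : Y, exists2 p : seq (medge Y), walk P p Q & [set` p] `<=` T.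

Definition connected_mgraph (Y : mgraph) : Prop :=
  [set: Y] !=set0 /\ connected_by [set: medge Y].

(* A loop is a circuit of length 1, and two parallel edges form one of
   length 2. *)
Definition circuit (Y : mgraph) (c : seq (medge Y)) : bool :=
  [&& 0 < size c,
      cycle (fun y z => (tgt y == src z) && (z != ebar y)) c &
      uniq [seq src y | y <- c]].

Definition spanning_tree (Y : mgraph) (T : set (medge Y)) : Prop :=
  [/\ forall y, T y -> T (ebar y),
      connected_by T &
      forall c : seq (medge Y), [set` c] `<=` T -> ~~ circuit c].

Definition finite_mgraph (Y : mgraph) : Prop :=
  finite_set [set: Y] /\ finite_set [set: medge Y].

(* [etrans y a] is the element a^(ebar y); only its values on [egroup y]
   matter.  Since [src (ebar (ebar y))] and [src y] are only propositionally
   equal, (a^(ebar y))^y = a is stated in the disjoint union of the vertex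
   groups. *)
Record graph_of_groups := GraphOfGroups {
  base :> mgraph;
  base_connected : connected_mgraph base;
  vgroup : base -> groupType;
  egroup : forall y : medge base, set (vgroup (src y));
  egroup_subgroup : forall y, is_subgroup (@egroup y);
  etrans : forall y : medge base, vgroup (src y) -> vgroup (src (ebar y));
  etrans_egroup : forall y a, @egroup y a -> @egroup (ebar y) (@etrans y a);
  etransM : forall y a b, @egroup y a -> @egroup y b ->
    @etrans y (a * b) = @etrans y a * @etrans y b;
  etransK : forall y a, @egroup y a ->
    Tagged vgroup (@etrans (ebar y) (@etrans y a)) = Tagged vgroup a
}.
Arguments vgroup {g} _.
Arguments egroup {g} _ _.
Arguments etrans {g} _ _.

Definition pi1_gen (Y : graph_of_groups) : choiceType :=
  ({P : Y & vgroup P} + medge Y)%type.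

Definition gvertex (Y : graph_of_groups) (P : Y) (a : vgroup P) :
    pi1_gen Y * bool :=
  gen (inl (Tagged (@vgroup Y) a)).
Definition gedge (Y : graph_of_groups) (y : medge Y) : pi1_gen Y * bool :=
  gen (inr y).

(* The relations [pi1_mul] alone present the free product of the vertex groups
   and of the free group on the edges. *)
Inductive pi1_rel (Y : graph_of_groups) (T : set (medge Y)) :
    word (pi1_gen Y) -> word (pi1_gen Y) -> Prop :=
| pi1_mul (P : Y) (a b : vgroup P) :
    pi1_rel T [:: gvertex a; gvertex b] [:: gvertex (a * b)]
| pi1_bar (y : medge Y) : pi1_rel T [:: gedge (ebar y); gedge y] [::]
| pi1_conj (y : medge Y) (a : vgroup (src y)) : egroup y a ->
    pi1_rel T [:: gedge (ebar y); gvertex a; gedge y] [:: gvertex (etrans y a)]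
| pi1_tree (y : medge Y) : T y -> pi1_rel T [:: gedge y] [::].

Definition pi1 (Y : graph_of_groups) (T : set (medge Y)) : groupType :=
  presented (@pi1_rel Y T).

(* The isomorphism type of [pi1 T] does not depend on the spanning tree. *)
Definition is_fundamental_group (Y : graph_of_groups) (G : groupType) : Prop :=
  exists2 T : set (medge Y), spanning_tree T & isomorphic G (pi1 T).

(* Main.v *)
Require Import Defs.
From HB Require Import structures.
From mathcomp Require Import fingroup perm.
From mathcomp Require Import all_boot finmap.
From mathcomp Require Import boolp classical_sets cardinality filter.

(** The group is made to act on a tree with finite stabilizers and finitely many
    orbits; Bass-Serre theory then gives both conclusions.

    The edges of the tree are cuts of the graph: sets of vertices with at most
    [k] boundary edges, connected with connected complement.  Only finitely many
    of them separate two given vertices ([finite_kcuts_separating], by a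
    compactness argument).  For each pair of ultrafilters on the vertices
    separated by such a set, consider the separating sets with the fewest
    boundary edges and, among these, the ones crossing the fewest cuts.  Both
    quantities are submodular over opposite corners, so any two cuts obtained in
    this way, even from different pairs, are nested ([optimal_cuts_nested]).

    A nested family of cuts, closed under complement and with finitely many
    members between any two vertices, is the edge set of a tree ([cut_tree]).
    Its vertices are the consistent choices of a side of every cut that differ
    finitely from the choice made by a vertex of the graph; midpoints of the
    edges are added because an element of the group may exchange a cut with its
    complement.

    Edge stabilizers are finite since boundaries are.  The stabilizer of a
    vertex of the tree acts with finitely many orbits on a coarsely connected
    set of vertices of the graph.  If it were infinite, bounded treewidth would
    provide a separator of bounded size splitting that set into two infinite
    parts ([treewidth_split]): otherwise each bag would point towards almost all
    of the set, uniformly so by coarse connectedness, and following these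
    pointers would decrease forever the distance to a large finite part of it.
    Ultrafilters concentrated on the two parts would then be separated by an
    optimal cut, although the vertex of the tree chooses the same side of it for
    both ([orientation_stabilizer_finite]).  Here [k] bounds the number of edges
    meeting a bag.

    For an action on a tree, choose representatives of the vertex orbits that
    span a subtree, and representatives of the edge orbits that start there.
    Compatible homomorphisms from the stabilizers and values on the edges define
    a homomorphism from the whole group, since labels on the edges of a tree
    integrate to labels on its vertices ([hom_extension]).  With the fundamental
    group of the quotient graph of groups as target this is an isomorphism
    ([quotient_gog_pi1]).  With a symmetric group as target, starting from
    permutation representations in which the stabilizers act freely, which are
    conjugate on edge stabilizers, its kernel has finite index and meets every
    stabilizer trivially ([tree_finite_quotient]).  With a free group as target
    it shows that a group acting freely on a tree is free ([free_action_free]),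
    which applies to this kernel. *)

Set Implicit Arguments.
Unset Strict Implicit.
Unset Printing Implicit Defensive.

Local Open Scope group_scope.
Local Open Scope classical_set_scope.

(** * Sizes of finite sets *)

Definition csize (T : choiceType) (A : set T) : nat := #|` fset_set A|.

Section Size.
Variable T : choiceType.
Implicit Types A B : set T.

Lemma csize_le A B : finite_set B -> A `<=` B -> csize A <= csize B.
Proof.
move=> fB AB; apply: fsubset_leq_card.
by rewrite -fset_set_sub //; apply: sub_finite_set AB fB.
Qed.

Lemma csize_lt A B x : finite_set B -> A `<=` B -> B x -> ~ A x ->
  csize A < csize B.
Proof.
move=> fB AB Bx nAx; have fA := sub_finite_set AB fB.
have sAB : (fset_set A `<=` fset_set B)%fset by rewrite -fset_set_sub.
apply: fproper_ltn_card; rewrite fproperEneq sAB andbT.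
by apply/eqP=> /(fset_set_inj fA fB) eAB; apply: nAx; rewrite eAB.
Qed.

Lemma csizeUI A B : finite_set A -> finite_set B ->
  (csize (A `|` B) + csize (A `&` B) = csize A + csize B)%N.
Proof. by move=> fA fB; rewrite /csize fset_setU // fset_setI // cardfsUI. Qed.

(** Inclusion-exclusion turns submodularity of a count into two inclusions. *)
Lemma csize_submod A B A' B' : finite_set A -> finite_set B ->
  A' `|` B' `<=` A `|` B -> A' `&` B' `<=` A `&` B ->
  (csize A' + csize B' <= csize A + csize B)%N.
Proof.
move=> fA fB sU sI; have fU : finite_set (A `|` B) by rewrite finite_setU.
have fU' := sub_finite_set sU fU.
have [fA' fB'] : finite_set A' /\ finite_set B' by rewrite -finite_setU.
rewrite -(csizeUI fA fB) -(csizeUI fA' fB'); apply: leq_add; apply: csize_le => //.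
exact: sub_finite_set (@subIsetl _ _ _) fA.
Qed.

Lemma csize_submod_lt A B A' B' x : finite_set A -> finite_set B ->
  A' `|` B' `<=` A `|` B -> A' `&` B' `<=` A `&` B ->
  (A `|` B) x -> ~ (A' `|` B') x ->
  (csize A' + csize B' < csize A + csize B)%N.
Proof.
move=> fA fB sU sI Ux nU'x; have fU : finite_set (A `|` B) by rewrite finite_setU.
have fU' := sub_finite_set sU fU.
have [fA' fB'] : finite_set A' /\ finite_set B' by rewrite -finite_setU.
rewrite -(csizeUI fA fB) -(csizeUI fA' fB') -addSn; apply: leq_add; first exact: csize_lt Ux nU'x.
apply: csize_le => //; exact: sub_finite_set (@subIsetl _ _ _) fA.
Qed.

Lemma csize_setU_le A B : finite_set A -> finite_set B ->
  (csize (A `|` B) <= csize A + csize B)%N.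
Proof. by move=> fA fB; rewrite -(csizeUI fA fB) leq_addr. Qed.

End Size.

Lemma csize_image (T U : choiceType) (f : T -> U) (A : set T) :
  finite_set A -> (csize (f @` A) <= csize A)%N.
Proof. by move=> fA; rewrite /csize fset_set_image // leq_imfset_card. Qed.

Lemma csize_image_inj (T U : choiceType) (f : T -> U) (A : set T) :
  finite_set A -> injective f -> csize (f @` A) = csize A.
Proof. by move=> fA fI; rewrite /csize fset_set_image // card_imfset. Qed.

Lemma ex_minimum (T : Type) (P : T -> Prop) (f : T -> nat) :
  (exists x, P x) -> exists2 x, P x & forall y, P y -> f x <= f y.
Proof.
move=> [x Px]; have [n] := ubnP (f x).
elim: n x Px => // n IHn x Px; rewrite ltnS => fx.
have [[y Py yx]|h] := pselect (exists2 y, P y & f y < f x).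
  by apply: (IHn y Py); apply: leq_trans yx fx.
by exists x => // y Py; rewrite leqNgt; apply/negP => yx; apply: h; exists y.
Qed.

Lemma ex_maximum_seq (T : eqType) (f : T -> nat) (s : seq T) : 0 < size s ->
  exists2 x, x \in s & forall y, y \in s -> f y <= f x.
Proof.
elim: s => // x [|x' s] IHs _.
  by exists x; rewrite ?mem_head // => y; rewrite inE => /eqP->.
have [//|z zs zmax] := IHs; have [xz|zx] := leqP (f x) (f z).
  by exists z => [|y]; rewrite inE ?zs ?orbT // => /orP[/eqP->|/zmax].
exists x; first exact: mem_head.
by move=> y; rewrite inE => /orP[/eqP->//|/zmax/leq_trans]; apply; apply: ltnW.
Qed.

(** * Ultrafilters *)

Section Ultra.
Variables (T : Type) (U : set_system T).
Hypothesis UU : UltraFilter U.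

Lemma ultraC (A : set T) : U (~` A) <-> ~ U A.
Proof.
split=> [UnA UA|nUA]; last by case: (in_ultra_setVsetC A UU).
by apply: (filter_not_empty U); rewrite -(setICr A); apply: filterI.
Qed.

Lemma ultraI (A B : set T) : U (A `&` B) <-> U A /\ U B.
Proof.
split=> [UAB|[UA UB]]; last exact: filterI.
by split; apply: filterS UAB; [apply: subIsetl|apply: subIsetr].
Qed.

End Ultra.

(** An ultrafilter above the filter of the cofinite subsets of [B]. *)
Lemma infinite_ultrafilter (T : choiceType) (B : set T) : infinite_set B ->
  exists2 U : set_system T, UltraFilter U &
    forall A, finite_set (B `\` A) -> U A.
Proof.
move=> iB; pose F := [set A : set T | finite_set (B `\` A)].
have FF : ProperFilter F.
  split; first by rewrite /F /= setD0.
  split=> [|A A' FA FA'|A A' sAA'].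
  - by rewrite /F /= setDT; apply: finite_set0.
  - by rewrite /F /= setDIr finite_setU.
  - by apply: sub_finite_set => x [Bx nA'x]; split=> // /sAA'.
by have [U [UU FU]] := ultraFilterLemma FF; exists U.
Qed.

(** * Cuts of a graph *)

Section Cuts.
Variable Γ : sgraph.
Hypothesis Γ_connected : connected_graph Γ.
Implicit Types C D F : set Γ.

Definition boundary C : set (Γ * Γ) :=
  [set e | [/\ adj e.1 e.2, C e.1 & ~ C e.2]].

Definition cut_size C := csize (boundary C).

Definition finite_boundary C := finite_set (boundary C).

Lemma boundaryC C : boundary (~` C) = (fun e => (e.2, e.1)) @` boundary C.
Proof.
apply/seteqP; split=> [[u v] [/= uv nCu /contrapT Cv]|_ [[u v] [/= uv Cu nCv] <-]].
  by exists (v, u) => //; split; rewrite //= adj_sym.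
by split=> //=; rewrite adj_sym.
Qed.

Lemma finite_boundaryC C : finite_boundary C -> finite_boundary (~` C).
Proof. by move=> fC; rewrite /finite_boundary boundaryC; apply: finite_image. Qed.

Lemma cut_sizeC C : finite_boundary C -> cut_size (~` C) = cut_size C.
Proof.
by move=> fC; rewrite /cut_size boundaryC csize_image_inj // => -[a b] [c d] [-> ->].
Qed.

(** The only consequence of connectedness that the theory of cuts needs: a path
    from [x] to [y] leaves [C]. *)
Lemma boundary_neq0 C x y : C x -> ~ C y -> boundary C !=set0.
Proof.
move=> Cx nCy; have [p + ep] := Γ_connected x y.
elim: p x Cx ep => [|z p IHp] x Cx /=; first by move=> xy; case: nCy; rewrite -xy.
move=> ep /andP[xz zp]; have [Cz|nCz] := pselect (C z); first exact: (IHp z).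
by exists (x, z).
Qed.

(** With [boundary_cornerI], the two inclusions behind the submodularity of the
    size of the boundary. *)
Lemma boundary_cornerU C D :
  boundary (C `&` D) `|` boundary (C `|` D) `<=` boundary C `|` boundary D.
Proof.
move=> [u v] [[/= uv [Cu Du] nv]|[/= uv Cu nv]].
  by case: (pselect (C v)) => Cv; [right|left]; split=> // Dv; apply: nv.
have [nCv nDv] : ~ C v /\ ~ D v by split=> h; apply: nv; [left|right].
by case: Cu => h; [left|right].
Qed.

Lemma boundary_cornerI C D :
  boundary (C `&` D) `&` boundary (C `|` D) `<=` boundary C `&` boundary D.
Proof.
move=> [u v] [[/= uv [Cu Du] nv] [/= _ _ nv']].
by split; split=> // h; apply: nv'; [left|right].
Qed.

Lemma finite_boundaryI C D :
  finite_boundary C -> finite_boundary D -> finite_boundary (C `&` D).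
Proof.
move=> fC fD; apply: (@sub_finite_set _ _ (boundary C `|` boundary D)).
  by move=> e he; apply: boundary_cornerU; left.
by rewrite finite_setU.
Qed.

Lemma cut_size_submod C D : finite_boundary C -> finite_boundary D ->
  (cut_size (C `&` D) + cut_size (~` C `&` ~` D) <= cut_size C + cut_size D)%N.
Proof.
move=> fC fD; rewrite -setCU cut_sizeC.
  by apply: csize_submod => //; [apply: boundary_cornerU|apply: boundary_cornerI].
rewrite -[_ `|` _]setCK setCU; apply/finite_boundaryC/finite_boundaryI;
exact: finite_boundaryC.
Qed.

(** Connectedness of the induced subgraph, expressed without paths. *)
Definition cohesive C := forall D, D `<=` C -> D !=set0 ->
  (forall u v, adj u v -> D u -> C v -> D v) -> C `<=` D.

Lemma not_cohesive C : ~ cohesive C -> exists D, [/\ D `<=` C, D !=set0,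
  (C `\` D) !=set0 & forall u v, adj u v -> D u -> C v -> D v].
Proof.
move=> /existsNP[D] /not_implyP[DC] /not_implyP[D0] /not_implyP[Dadj].
by move=> /existsNP[x] /not_implyP[Cx nDx]; exists D; split=> //; exists x.
Qed.

Lemma boundary_split C D : D `<=` C ->
  (forall u v, adj u v -> D u -> C v -> D v) -> boundary D `<=` boundary C.
Proof. by move=> DC Dadj [u v] [/= uv /[dup] Du /DC Cu nDv]; split=> //= Cv;
apply: nDv; apply: (Dadj u). Qed.

(** A piece of [C] without edges to the rest of [C] takes over part of the
    boundary of [C]; the rest of [C] keeps at least one edge by connectedness.
    *)
Lemma cut_size_split C D : finite_boundary C -> D `<=` C -> (C `\` D) !=set0 ->
  (exists y, ~ C y) -> (forall u v, adj u v -> D u -> C v -> D v) ->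
  cut_size D < cut_size C.
Proof.
move=> fC DC [x [Cx nDx]] [y nCy] Dadj.
have [[u v] [/= uv [Cu nDu] nv]] : boundary (C `\` D) !=set0.
  by apply: (@boundary_neq0 _ x y) => // -[].
apply: (@csize_lt _ _ _ (u, v)) => //; first exact: boundary_split.
- split=> //= Cv; apply: nv; split=> // Dv; apply: nDu; apply: (Dadj v) => //.
  by rewrite adj_sym.
- by case.
Qed.

Lemma split_sym C D : (forall u v, adj u v -> D u -> C v -> D v) ->
  forall u v, adj u v -> (C `\` D) u -> C v -> (C `\` D) v.
Proof.
move=> Dadj u v uv [Cu nDu] Cv; split=> // Dv; apply: nDu.
by apply: (Dadj v) => //; rewrite adj_sym.
Qed.

Definition kcut k C :=
  [/\ finite_boundary C, cut_size C <= k, cohesive C & cohesive (~` C)].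

(** A limit along an ultrafilter of infinitely many such cuts has finite
    boundary, so the boundary of the limit is part of the boundary of some, in
    fact of almost every, member; by cohesion that member is then the limit. *)
Lemma finite_kcuts_separating k x y :
  finite_set [set C | [/\ kcut k C, C x & ~ C y]].
Proof.
set 𝒞 := [set C | _]; apply: contrapT => /infinite_ultrafilter[U UU Ucof].
have U𝒞 : U 𝒞 by apply: Ucof; rewrite setDv.
pose L : set Γ := [set v | U [set C | C v]].
have Lb e : boundary L e -> U [set C | boundary C e].
  case: e => u v [/= uv Lu /(ultraC UU) nLv].
  by apply: filterS (filterI Lu nLv) => C [Cu nCv].
have Ub (s : {fset Γ * Γ}) : [set` s] `<=` boundary L ->
    U [set C | 𝒞 C /\ [set` s] `<=` boundary C].
  move=> sL; have := @filter_bigI _ _ s (fun e => [set C | boundary C e]) U _.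
  move=> /(_ _ (fun e es => Lb e (sL e es))) Us.
  by apply: filterS (filterI U𝒞 Us) => C [? h]; split=> // e /h.
have fL : finite_boundary L.
  apply: contrapT => /(@infinite_set_fset _ _ k.+1)[s sL ks].
  have [C [[[fC Ck _ _] _ _] sC]] := filter_ex (Ub s sL).
  have := csize_le fC sC; rewrite /csize set_fsetK => /(leq_trans ks).
  by move=> /leq_trans/(_ Ck); rewrite ltnn.
have Lx : L x by apply: filterS U𝒞 => C [].
have nLy : ~ L y.
  by move=> /(filterI U𝒞) /filter_ex[C [[_ _ nCy] /nCy]].
have UL : U [set C | C = L].
  have := Ub (fset_set (boundary L)); rewrite fset_setK // => /(_ (fun _ => id)).
  apply: filterS => C [[[_ _ cC cC'] Cx nCy] LC].
  have CL : C `<=` C `&` L.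
    apply: cC; [exact: subIsetl|by exists x|move=> u v uv [Cu Lu] Cv; split=> //].
    by apply: contrapT => nLv; have [] := LC (u, v).
  have CL' : ~` C `<=` ~` C `&` ~` L.
    apply: cC'; [exact: subIsetl|by exists y|move=> u v uv [Cu nLu] Cv; split=> //].
    by move=> Lv; have [] := LC (v, u) => //; split; rewrite //= adj_sym.
  apply/seteqP; split=> v; first by move=> /CL[].
  by apply: contraPP => /CL'[].
have : U [set C | C <> L].
  apply: Ucof; apply: (@sub_finite_set _ _ [set L]); last exact: finite_set1.
  by move=> C [_ /contrapT].
by move=> /(filterI UL) /filter_ex[C []].
Qed.

Definition cross C D := [/\ (C `&` D) !=set0, (C `&` ~` D) !=set0,
  (~` C `&` D) !=set0 & (~` C `&` ~` D) !=set0].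

Lemma crossC C D : cross C D -> cross D C.
Proof. by case=> h1 h2 h3 h4; split; rewrite setIC. Qed.

Lemma crossNr C D : cross C (~` D) <-> cross C D.
Proof. by split=> -[h1 h2 h3 h4]; split; rewrite // ?setCK // -[D]setCK. Qed.

Lemma crossNl C D : cross (~` C) D <-> cross C D.
Proof. by split=> /crossC h; apply: crossC; move: h => /crossNr. Qed.

Lemma nested_cases C D : ~ cross C D ->
  [\/ C `<=` D, C `<=` ~` D, ~` C `<=` D | D `<=` C].
Proof.
have sub (A B : set Γ) : ~ ((A `&` ~` B) !=set0) -> A `<=` B.
  by move=> h x Ax; apply: contrapT => nBx; apply: h; exists x.
move=> nCD; apply: contrapT => h; apply: nCD; split; apply: contrapT => h'; apply: h;
  [constructor 2|constructor 1|constructor 4|constructor 3]; apply: sub.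
- by rewrite setCK.
- by [].
- by rewrite setIC.
- by [].
Qed.

Definition crossing k C : set (set Γ) := [set F | kcut k F /\ cross F C].

(** A cohesive set that meets both [C] and its complement contains an edge of
    the boundary of [C]; hence a cut crossing [C] separates two ends of edges
    of that finite boundary. *)
Lemma finite_crossing k C : finite_boundary C -> finite_set (crossing k C).
Proof.
move=> fC; have fV : finite_set (fst @` boundary C) by apply: finite_image.
have inside F : cohesive F -> (F `&` C) !=set0 -> (F `&` ~` C) !=set0 ->
    exists2 u, (fst @` boundary C) u & F u.
  move=> cF FC [y [Fy nCy]]; apply: contrapT => noedge.
  have /(_ y Fy)[] // : F `<=` F `&` C.
  apply: cF => // u v uv [Fu Cu] Fv.
  by split=> //; apply: contrapT => nCv; apply: noedge; exists u => //; exists (u, v).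
apply: (@sub_finite_set _ _ (\bigcup_(x in fst @` boundary C)
  \bigcup_(y in fst @` boundary C) [set F | [/\ kcut k F, F x & ~ F y]])).
  move=> F [kF [h1 h2 h3 h4]]; have [_ _ cF cF'] := kF.
  have [u bu Fu] := inside F cF h1 h2; have [v bv Fv] := inside _ cF' h3 h4.
  by exists u => //; exists v.
apply: bigcup_finite => // x _; apply: bigcup_finite => // y _.
exact: finite_kcuts_separating.
Qed.

Lemma crossingC k C : crossing k (~` C) = crossing k C.
Proof. by apply/seteqP; split=> F [kF /crossNr h]. Qed.

Lemma cross_corner F C D : cross C D -> cross F (C `&` D) -> cross F C \/ cross F D.
Proof.
move=> [_ _ _ [w [nCw nDw]]] [[a [Fa [Ca Da]]] [b [Fb nb]] [c [nFc [Cc Dc]]] [d [nFd nd]]].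
have [hC|hC] := pselect ((F `&` ~` C) !=set0 /\ (~` F `&` ~` C) !=set0).
  by left; case: hC => ? ?; split=> //; [exists a|exists c].
right; split; [by exists a| |by exists c|].
- have [Db|nDb] := pselect (D b); last by exists b.
  have nCb : ~ C b by move=> Cb; apply: nb.
  exists w; split=> //; apply: contrapT => nFw; apply: hC.
  by split; [exists b|exists w].
- have [Dd|nDd] := pselect (D d); last by exists d.
  have nCd : ~ C d by move=> Cd; apply: nd.
  exists w; split=> //; move=> Fw; apply: hC.
  by split; [exists w|exists d].
Qed.

(** A cut crossing a corner crosses [C] or [D], and a cut crossing both opposite
    corners crosses both. Strictness comes from [C], which crosses [D] but is
    nested with the corners. *)
Lemma crossing_submod k C D : finite_boundary C -> finite_boundary D ->
  kcut k C -> cross C D ->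
  (csize (crossing k (C `&` D)) + csize (crossing k (~` C `&` ~` D)) <
   csize (crossing k C) + csize (crossing k D))%N.
Proof.
move=> fC fD kC xCD.
have nself A B : ~ cross A (A `&` B) by case=> _ _ [x [nAx []]].
apply: (@csize_submod_lt _ _ _ _ _ C).
- exact: finite_crossing.
- exact: finite_crossing.
- move=> F [] [kF xF].
    by case: (cross_corner xCD xF); [left|right].
  have xCD' : cross (~` C) (~` D) by apply/crossNl/crossNr.
  by case: (cross_corner xCD' xF) => /crossNr; [left|right].
- move=> F [[kF [[a [Fa [Ca Da]]] _ [c [nFc [Cc Dc]]] _]]].
  move=> [_ [[a' [Fa' [Ca' Da']]] _ [c' [nFc' [Cc' Dc']]] _]].
  by split; split=> //; split; by [exists a|exists a'|exists c|exists c'].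
- by right.
- by case=> -[_]; [apply: nself|move=> /crossNl; apply: nself].
Qed.

(** * Optimal cuts *)

(** Ultrafilters on the vertices play the role of the ends of the graph: each
    lies on a definite side of every cut. *)
Definition separates (ξ η : set_system Γ) C := ~ (ξ C <-> η C).

Definition minimal_cut ξ η C := [/\ finite_boundary C, separates ξ η C &
  forall D, finite_boundary D -> separates ξ η D -> cut_size C <= cut_size D].

(** Among the minimal cuts between two ultrafilters, those crossing the fewest
    others; minimality alone does not make cuts nested. *)
Definition optimal_cut k ξ η C := [/\ minimal_cut ξ η C, cut_size C <= k &
  forall D, minimal_cut ξ η D -> csize (crossing k C) <= csize (crossing k D)].

Definition optimal_cuts k : set (set Γ) := [set C |
  exists ξ η, [/\ UltraFilter ξ, UltraFilter η & optimal_cut k ξ η C]].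

Section Pair.
Variables ξ η : set_system Γ.
Hypotheses (Uξ : UltraFilter ξ) (Uη : UltraFilter η).

Lemma separatesC C : separates ξ η (~` C) <-> separates ξ η C.
Proof. by rewrite /separates !ultraC //; tauto. Qed.

Lemma minimal_cutC C : minimal_cut ξ η C -> minimal_cut ξ η (~` C).
Proof.
move=> [fC sC mC]; split; [exact: finite_boundaryC|exact/separatesC|].
by move=> D; rewrite cut_sizeC //; apply: mC.
Qed.

Lemma optimal_cutC k C : optimal_cut k ξ η C -> optimal_cut k ξ η (~` C).
Proof.
move=> [mC Ck oC]; have [fC _ _] := mC.
by split; [exact: minimal_cutC|rewrite cut_sizeC|rewrite crossingC].
Qed.

Lemma separates_neq C : separates ξ η C -> (exists x, C x) /\ (exists y, ~ C y).
Proof.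
move=> sC; split; apply: contrapT => h; apply: sC.
  have -> : C = set0 by apply/seteqP; split=> x // Cx; case: h; exists x.
  by split=> /(@filter_not_empty _ _ (ultra_proper (UltraFilter := _))).
have -> : C = setT.
  by apply/seteqP; split=> x // _; apply: contrapT => nCx; case: h; exists x.
by split=> _; apply: filterT.
Qed.

(** Otherwise one of two pieces of [C], each with a smaller boundary, would
    still separate. *)
Lemma minimal_cut_cohesive C : minimal_cut ξ η C -> cohesive C.
Proof.
move=> [fC sC mC]; apply: contrapT => /not_cohesive[D [DC D0 CD Dadj]].
have [_ nC] := separates_neq sC.
have [fD fCD] : finite_boundary D /\ finite_boundary (C `\` D).
  split; apply: sub_finite_set fC; apply: boundary_split => //.
  exact: split_sym.
have sD : ~ separates ξ η D.
  by move=> /(mC _ fD); rewrite leqNgt => /negP; apply; apply: cut_size_split.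
have sCD : ~ separates ξ η (C `\` D).
  move=> /(mC _ fCD); rewrite leqNgt => /negP; apply; apply: cut_size_split => //.
  - by case: D0 => x Dx; exists x; split; [apply: DC|case].
  - exact: split_sym.
move: sD sCD sC; rewrite /separates setDE !ultraI // !ultraC //.
have sub (U : set_system Γ) : UltraFilter U -> U D -> U C.
  by move=> UU; apply: filterS.
have := sub _ Uξ; have := sub _ Uη; tauto.
Qed.

Lemma optimal_kcut k C : optimal_cut k ξ η C -> kcut k C.
Proof.
move=> [mC Ck _]; have [fC _ _] := mC; split=> //; first exact: minimal_cut_cohesive mC.
by apply: minimal_cut_cohesive; apply: minimal_cutC.
Qed.

Lemma minimal_cut_eq C D : minimal_cut ξ η C -> finite_boundary D ->
  separates ξ η D -> cut_size D <= cut_size C -> minimal_cut ξ η D.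
Proof.
by move=> [_ _ mC] fD sD DC; split=> // E fE /(mC E fE); apply: leq_trans.
Qed.

End Pair.

(** Both the size of the boundary and the number of crossing cuts are
    submodular over opposite corners, the second strictly. *)
Lemma opposite_corners k ξ η ξ' η' C D :
  UltraFilter ξ -> UltraFilter η -> UltraFilter ξ' -> UltraFilter η' ->
  optimal_cut k ξ η C -> optimal_cut k ξ' η' D -> cross C D ->
  separates ξ η (C `&` D) -> separates ξ' η' (~` C `&` ~` D) -> False.
Proof.
move=> Uξ Uη Uξ' Uη' oC oD xCD sE sE'; have kC := optimal_kcut Uξ Uη oC.
have [mC Ck optC] := oC; have [mD Dk optD] := oD.
have [fC sC minC] := mC; have [fD sD minD] := mD.
have fE := finite_boundaryI fC fD.
have fE' := finite_boundaryI (finite_boundaryC fC) (finite_boundaryC fD).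
have := cut_size_submod fC fD => le.
have leE := minC _ fE sE; have leE' := minD _ fE' sE'.
have mE : minimal_cut ξ η (C `&` D).
  apply: minimal_cut_eq mC fE sE _.
  by rewrite -(leq_add2r (cut_size D)); apply: leq_trans le; rewrite leq_add2l.
have mE' : minimal_cut ξ' η' (~` C `&` ~` D).
  apply: minimal_cut_eq mD fE' sE' _.
  by rewrite -(leq_add2l (cut_size C)); apply: leq_trans le; rewrite leq_add2r.
have := crossing_submod fC fD kC xCD; rewrite ltnNge => /negP; apply.
by apply: leq_add; [apply: optC|apply: optD].
Qed.

(** Of the corners of two crossing cuts, each of the four ultrafilters picks
    one.  Unless the two pairs occupy different pairs of opposite corners, some
    corner splits the first pair while its opposite splits the second; in the
    exceptional case either cut is optimal for both pairs. *)
Lemma optimal_cuts_nested k C D :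
  optimal_cuts k C -> optimal_cuts k D -> ~ cross C D.
Proof.
move=> [ξ [η [Uξ Uη oC]]] [ξ' [η' [Uξ' Uη' oD]]] xCD.
have oC' := optimal_cutC Uξ Uη oC; have oD' := optimal_cutC Uξ' Uη' oD.
have [mC Ck optC] := oC; have [mD Dk optD] := oD.
have [fC sC minC] := mC; have [fD sD minD] := mD.
have c1 := opposite_corners Uξ Uη Uξ' Uη' oC oD xCD.
have c2 := opposite_corners Uξ Uη Uξ' Uη' oC oD' ((crossNr _ _).2 xCD).
have c3 := opposite_corners Uξ Uη Uξ' Uη' oC' oD ((crossNl _ _).2 xCD).
have c4 := opposite_corners Uξ Uη Uξ' Uη' oC' oD'
  ((crossNl _ _).2 ((crossNr _ _).2 xCD)).
(* The exceptional case is the one where each cut separates both pairs. *)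
have [sCD|] := pselect (separates ξ η D /\ separates ξ' η' C); last first.
  move: c1 c2 c3 c4 sC sD; rewrite /separates !setCK.
  by do !rewrite ?ultraI ?ultraC //; tauto.
have [sD' sC'] := sCD.
have eCD : cut_size C = cut_size D.
  by apply/eqP; rewrite eqn_leq minC // minD.
have mD1 : minimal_cut ξ η D by apply: minimal_cut_eq mC _ _ _; rewrite // eCD.
have mC1 : minimal_cut ξ' η' C by apply: minimal_cut_eq mD _ _ _; rewrite // eCD.
have oD1 : optimal_cut k ξ η D.
  by split=> // E /optC; apply: leq_trans; apply: optD.
have oD1' := optimal_cutC Uξ Uη oD1.
have d1 := opposite_corners Uξ Uη Uξ Uη oC oD1 xCD.
have d2 := opposite_corners Uξ Uη Uξ Uη oC oD1' ((crossNr _ _).2 xCD).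
move: d1 d2 sC sD'; rewrite /separates !setCK.
by do !rewrite ?ultraI ?ultraC //; tauto.
Qed.

Lemma optimal_cutsC k C : optimal_cuts k C -> optimal_cuts k (~` C).
Proof.
move=> [ξ [η [Uξ Uη oC]]]; exists ξ, η; split=> //; exact: optimal_cutC.
Qed.

Lemma optimal_cuts_kcut k C : optimal_cuts k C -> kcut k C.
Proof. by move=> [ξ [η [Uξ Uη oC]]]; apply: optimal_kcut oC. Qed.

Lemma optimal_cuts_neq0 k C : optimal_cuts k C -> C !=set0.
Proof.
by move=> [ξ [η [Uξ Uη [[_ sC _] _ _]]]]; case: (separates_neq Uξ Uη sC).
Qed.

Lemma optimal_cut_exists k ξ η D : UltraFilter ξ -> UltraFilter η ->
  finite_boundary D -> cut_size D <= k -> separates ξ η D ->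
  exists2 C, optimal_cuts k C & separates ξ η C.
Proof.
move=> Uξ Uη fD Dk sD.
have [C [fC sC] minC] := @ex_minimum _ (fun C => finite_boundary C /\ separates ξ η C)
  cut_size (ex_intro _ D (conj fD sD)).
have mC : minimal_cut ξ η C by split=> // E fE sE; apply: minC.
have [E mE optE] := @ex_minimum _ (minimal_cut ξ η) (fun C => csize (crossing k C))
  (ex_intro _ C mC).
have [fE sE minE] := mE.
exists E => //; exists ξ, η; split=> //; split=> //.
by apply: leq_trans Dk; apply: minE.
Qed.

End Cuts.

Lemma size_le_csize (T : choiceType) (A : set T) (s : seq T) :
  finite_set A -> uniq s -> (forall x, x \in s -> A x) -> size s <= csize A.
Proof.
move=> fA us sA; apply: uniq_leq_size => // x /sA Ax.
by rewrite in_fset_set // inE.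
Qed.

Lemma finite_bigcup_seq (I : eqType) (T : choiceType) (s : seq I) (F : I -> set T) d :
  (forall i, finite_set (F i) /\ csize (F i) <= d) ->
  finite_set (\bigcup_(i in [set` s]) F i) /\
  (csize (\bigcup_(i in [set` s]) F i) <= size s * d)%N.
Proof.
move=> Fd; elim: s => [|i s [IHf IHs]].
  rewrite (_ : \bigcup_(i in _) _ = set0); last by rewrite -subset0 => x [].
  by split; [apply: finite_set0|rewrite /csize fset_set0].
have [fFi Fid] := Fd i.
rewrite (_ : \bigcup_(j in _) _ = F i `|` \bigcup_(j in [set` s]) F j); last first.
  apply/seteqP; split=> [x [j /=]|x [Fx|[j js Fx]]].
  - by rewrite inE => /orP[/eqP->|js Fx]; [left|right; exists j].
  - by exists i; rewrite //= mem_head.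
  - by exists j => //=; rewrite inE js orbT.
split; first by rewrite finite_setU.
by apply: (leq_trans (csize_setU_le _ _)) => //; rewrite mulSn leq_add.
Qed.

(** * Trees and their edges *)

Section TreeSides.
Variable T : sgraph.
Hypothesis T_tree : is_tree T.
Implicit Types s t r u v : T.

(** Adjacency in the forest left after deleting the edge [st]. *)
Definition cut_adj s t : rel T :=
  [rel u v | adj u v && ~~ ((u == s) && (v == t) || (u == t) && (v == s))].

Definition side s t r := exists2 p : seq T, path (cut_adj s t) t p & last t p = r.

Lemma cut_adjC s t : cut_adj s t =2 cut_adj t s.
Proof. by move=> u v; rewrite /cut_adj /= orbC. Qed.

Lemma cut_adj_sym s t : symmetric (cut_adj s t).
Proof.
move=> u v; rewrite /cut_adj /= adj_sym [(v == t) && _]andbC [(v == s) && _]andbC.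
by rewrite [(u == s) && _ || _]orbC.
Qed.

Lemma side_refl s t : side s t t. Proof. by exists [::]. Qed.

Lemma side_step s t u v : side s t u -> cut_adj s t u v -> side s t v.
Proof.
by move=> [p tp <-] uv; exists (rcons p v); rewrite ?last_rcons // rcons_path tp.
Qed.

Lemma side_path s t u p : side s t u -> path (cut_adj s t) u p -> side s t (last u p).
Proof.
by elim: p u => //= v p IHp u su /andP[uv vp]; apply: IHp => //; apply: side_step uv.
Qed.

Lemma side_exhaust s t r : adj s t -> side s t r \/ side t s r.
Proof.
move=> st; have [_ /(_ t r)[p + <-] _] := T_tree.
suff gen q : forall u, side s t u \/ side t s u -> path adj u q ->
  side s t (last u q) \/ side t s (last u q).
  by apply: gen; left; apply: side_refl.
elim: q => //= v q IHq u su /andP[uv vq]; apply: IHq => //.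
have [euv|] := boolP (cut_adj s t u v).
  by case: su => su; [left|right]; apply: side_step su _; rewrite // cut_adjC.
rewrite /cut_adj /= uv negbK => /orP[] /andP[_ /eqP->].
- by left; apply: side_refl.
- by right; apply: side_refl.
Qed.

(** An edge of a tree lies on no cycle, so it is a bridge. *)
Lemma edge_bridge s t : adj s t -> ~ side s t s.
Proof.
move=> st [p0 tp0 ps0]; case/shortenP: tp0 ps0 => p tp Up _ ps.
have [_ _ /(_ (t :: p))] := T_tree; case: p tp Up ps => [|v [|w p]] /=.
- by move=> _ _ ts; rewrite ts adj_irr in st.
- by move=> /andP[+ _] _ vs; rewrite vs /cut_adj /= !eqxx orbT andbF.
- move=> tp Up ps /(_ isT Up) /negP; apply.
  have sub : subrel (cut_adj s t) (@adj T) by move=> x y /andP[].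
  move: tp => /= /and3P[tv vw wp]; rewrite (sub _ _ tv) (sub _ _ vw) /=.
  by rewrite rcons_path (sub_path sub wp) ps.
Qed.

Lemma side_excl s t r : adj s t -> side s t r -> side t s r -> False.
Proof.
move=> st sr [p sp pr]; apply: (edge_bridge st).
have : path (cut_adj s t) r (rev (belast s p)).
  rewrite -pr rev_path; apply: sub_path sp => u v.
  by rewrite cut_adj_sym cut_adjC.
move=> /(side_path sr); case: p sp pr => [|w p] _ /= pr; first by rewrite pr.
by rewrite rev_cons last_rcons.
Qed.

Lemma path_avoid s t u p : path adj u p -> s \notin u :: p \/ t \notin u :: p ->
  path (cut_adj s t) u p.
Proof.
elim: p u => //= v p IHp u /andP[uv vp] st; apply/andP; split.
  rewrite /cut_adj /= uv /=; apply/negP => /orP[] /andP[/eqP eu /eqP ev];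
  by move: st; rewrite -eu -ev !inE !eqxx ?orbT /= => -[].
by apply: IHp => //; case: st; rewrite inE negb_or => /andP[_ ?]; [left|right].
Qed.

Lemma side_through s t u p : adj s t -> path adj u p ->
  side t s u -> side s t (last u p) -> s \in u :: p /\ t \in u :: p.
Proof.
move=> st up su sp.
suff h : ~ (s \notin u :: p \/ t \notin u :: p).
  by split; apply: contrapT => /negP ?; apply: h; [left|right].
move=> /(path_avoid up) cp; apply: (side_excl st sp).
by apply: side_path => //; rewrite (eq_path (cut_adjC t s)).
Qed.

Lemma ex_geodesic u v : exists2 p, geodesic u p & last u p = v.
Proof.
have [_ /(_ u v)[p0 up0 p0v] _] := T_tree.
have [p [up pv] minp] := @ex_minimum _ (fun p => path adj u p /\ last u p = v)
  size (ex_intro _ p0 (conj up0 p0v)).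
by exists p => //; split=> // q uq; rewrite pv => qv; apply: minp.
Qed.

Definition dist u v := size (sval (cid2 (ex_geodesic u v))).

Lemma distP u v : exists p, [/\ path adj u p, last u p = v & size p = dist u v].
Proof. by rewrite /dist; case: cid2 => /= p [up _] pv; exists p. Qed.

Lemma dist_le u p : path adj u p -> dist u (last u p) <= size p.
Proof.
by move=> up; rewrite /dist; case: cid2 => /= q [_ minq] qp; apply: minq.
Qed.

Lemma dist_adj s t r : adj s t -> dist t r <= (dist s r).+1.
Proof.
move=> st; have [p [sp <- <-]] := distP s r.
by apply: (@dist_le t (s :: p)); rewrite /= adj_sym st.
Qed.

Lemma dist_side s t r : adj s t -> side s t r -> dist t r < dist s r.
Proof.
move=> st sr; have [p [sp pr <-]] := distP s r.
have [_] : s \in s :: p /\ t \in s :: p.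
  by apply: side_through; rewrite ?pr //; apply: side_refl.
rewrite inE => /orP[/eqP ts|tp]; first by rewrite ts adj_irr in st.
case/splitPr: tp sp pr => p1 p2; rewrite cat_path /= last_cat /= => /and3P[_ _ tp2] <-.
by rewrite size_cat /= addnS ltnS (leq_trans (dist_le tp2)) // leq_addl.
Qed.

End TreeSides.

(** * Splitting large sets in graphs of bounded treewidth *)

Section Treewidth.
Variables (Γ T : sgraph) (X : T -> {fset Γ}) (w d : nat).
Hypothesis X_decomp : tree_decomposition X.
Hypothesis X_width : forall t, #|` X t| <= w.
Hypothesis Γ_degree : forall v : Γ,
  finite_set [set u | adj v u] /\ csize [set u | adj v u] <= d.

Let T_tree : is_tree T. Proof. by case: X_decomp. Qed.

(** Every path between the two sides of the edge passes through [s]. *)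
Lemma bag_between s t r r' v : adj s t -> side t s r' -> side s t r ->
  v \in X r' -> v \in X r -> v \in X s.
Proof.
move=> st sr' sr vr' vr; have [_ _ _ convex] := X_decomp.
have [p gp pr] := ex_geodesic T_tree r' r; rewrite -pr in sr vr.
apply: (convex v r' p gp vr' vr).
by case: (side_through T_tree st (proj1 gp) sr' sr).
Qed.

(** A union of components of the graph deprived of the bag of [s]. *)
Definition branch s (A : set T) : set Γ := [set v | v \notin X s /\
  exists t r, [/\ A t, adj s t, side s t r & v \in X r]].

(** A bag containing an edge that starts in the branch lies on the far side, so
    the other end is in the branch unless it is in the bag of [s]. *)
Lemma branch_boundary s A :
  finite_boundary (branch s A) /\ cut_size (branch s A) <= w * d.
Proof.
pose F v := (fun u => (u, v)) @` [set u : Γ | adj v u].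
have FP v : finite_set (F v) /\ csize (F v) <= d.
  have [fv vd] := Γ_degree v; split; first exact: finite_image.
  exact: leq_trans (csize_image _ fv) vd.
have [fU Ud] := finite_bigcup_seq (X s) FP.
have sub : boundary (branch s A) `<=` \bigcup_(v in [set` X s]) F v.
  move=> [u v] [/= uv [us [t [r [At st sr ur]]]] nv].
  have [_ _ /(_ u v uv)[r' [ur' vr']] _] := X_decomp.
  have sr' : side s t r'.
    have [//|sr'] := side_exhaust T_tree r' st.
    by rewrite (bag_between st sr' sr ur' ur) in us.
  exists v; last by exists u => //=; rewrite adj_sym.
  apply/negPn/negP => vs; apply: nv; split=> //.
  by exists t, r'.
split; first exact: sub_finite_set sub fU.
apply: leq_trans (csize_le fU sub) _; apply: leq_trans Ud _.
by rewrite leq_mul2r X_width orbT.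
Qed.

Lemma branch_cover s v : v \notin X s -> exists2 t, adj s t & branch s [set t] v.
Proof.
move=> vs; have [_ /(_ v)[r vr] _ _] := X_decomp.
have [_ /(_ s r)[p0 sp0 pr0] _] := T_tree.
case/shortenP: sp0 pr0 => p sp Up _ pr; case: p sp Up pr => [|t p] /=.
  by move=> _ _ sr; rewrite sr vr in vs.
move=> /andP[st tp] /andP[sp _] pr; exists t => //; split=> //; exists t, r.
split=> //; exists p => //; apply: path_avoid => //; by left.
Qed.

Variables (M : set Γ) (N : nat).
Hypothesis M_infinite : infinite_set M.
Hypothesis M_small : forall D, finite_boundary D -> cut_size D <= w * d ->
  finite_set (M `&` D) -> csize (M `&` D) <= N.

(** If no cut of this size splits [M] into infinite parts, every bag points to
    the neighbouring bag behind which all but [N] elements of [M] lie.  Along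
    such a step the total distance to bags containing [2N + 1] chosen elements
    of [M] decreases, which cannot go on forever. *)
Lemma treewidth_split : exists D, [/\ finite_boundary D, cut_size D <= w * d,
  infinite_set (M `&` D) & infinite_set (M `&` ~` D)].
Proof.
apply: contrapT => nosplit.
have dich D : finite_boundary D -> cut_size D <= w * d ->
    finite_set (M `&` D) \/ finite_set (M `&` ~` D).
  move=> fD Dk; apply: contrapT => /not_orP[? ?]; apply: nosplit.
  by exists D.
have step s : exists t, [/\ adj s t, finite_set (M `\` branch s [set t]) &
    csize (M `\` branch s [set t]) <= N].
  apply: contrapT => nostep.
  have fin t : adj s t -> finite_set (M `&` branch s [set t]).
    move=> st; have [fB Bk] := branch_boundary s [set t].
    have [//|fM] := dich _ fB Bk; case: nostep; exists t; rewrite setDE; split=> //.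
    by apply: M_small => //; [apply: finite_boundaryC|rewrite cut_sizeC].
  have iMs : infinite_set (M `\` [set` X s]).
    by apply: infinite_setD => //; apply: finite_fset.
  have [B BM NB] := infinite_set_fset N.+1 iMs.
  have /choice[τ τP] v : exists t, v \in B -> adj s t /\ branch s [set t] v.
    have [vB|] := boolP (v \in B); last by exists s.
    have [_ /= /negP vs] := BM v vB.
    by have [t st tv] := branch_cover vs; exists t.
  pose A := τ @` [set` B].
  have [fA Ak] := branch_boundary s A.
  have fMA : finite_set (M `&` branch s A).
    apply: (@sub_finite_set _ _ (\bigcup_(v in [set` B]) (M `&` branch s [set τ v]))).
      move=> v [Mv [vs [_ [r [[u uB <-] st sr vr]]]]]; exists u => //; split=> //.
      by split=> //; exists (τ u), r.
    apply: bigcup_finite; first exact: finite_fset.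
    by move=> v /τP[st _]; apply: fin.
  have := M_small fA Ak fMA; apply/negP; rewrite -ltnNge; apply: leq_trans NB _.
  apply: size_le_csize => // v vB; have [Mv _] := BM v vB; split=> //.
  have [st [vs [_ [r [-> _ sr vr]]]]] := τP v vB.
  by split=> //; exists (τ v), r; split=> //; exists v.
(* More than half of the points of [F] lie in the branch that a bag points to. *)
have [F FM NF] := infinite_set_fset (N + N).+1 M_infinite.
have /choice[ρ ρP] v : exists r, v \in X r by case: X_decomp => _ /(_ v).
have [[s0 _] _ _] := T_tree.
pose pot s := \sum_(v <- F) dist T_tree s (ρ v).
have [s _ smin] := @ex_minimum _ (fun _ : T => True) pot (ex_intro _ s0 I).
have [t [st fMt Mt]] := step s.
pose b v := `[< branch s [set t] v >].
have le v : dist T_tree t (ρ v) + b v <= dist T_tree s (ρ v) + ~~ b v.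
  rewrite /b; case: asboolP => [[vs [_ [r [-> _ sr vr]]]]|_] /=; last first.
    by rewrite addn0 addn1; apply: dist_adj.
  rewrite addn0 addn1; apply: dist_side => //.
  have [//|sr'] := side_exhaust T_tree (ρ v) st.
  by rewrite (bag_between st sr' sr (ρP v) vr) in vs.
have : \sum_(v <- F) (dist T_tree t (ρ v) + b v) <=
    \sum_(v <- F) (dist T_tree s (ρ v) + ~~ b v) by apply: leq_sum.
have cnt (a : pred Γ) : \sum_(v <- F) a v = count a F.
  by rewrite -sum1_count [RHS]big_mkcond.
rewrite !big_split /= !cnt -/(pot t) -/(pot s).
have := smin t I.
have leN : count (fun v => ~~ b v) F <= N.
  rewrite -size_filter; apply: leq_trans Mt; apply: size_le_csize => //.
    by rewrite filter_uniq.
  move=> v; rewrite mem_filter => /andP[/asboolP nbv vF].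
  by split=> //; apply: FM.
have := count_predC b F; rewrite -/(predC b) => cF.
have gtN : N < count b F.
  move: NF; rewrite -cF => NF; rewrite ltnNge; apply/negP => h.
  by move: NF; rewrite ltnNge leq_add.
move=> st_le ts_le; have := leq_trans ts_le (leq_add st_le leN).
by rewrite leq_add2l leqNgt gtN.
Qed.

End Treewidth.

(** * Rooted trees and group actions on them *)

(** A tree, given by a height function with respect to a root: every other
    vertex has exactly one edge leading to a lower vertex.  The group will
    preserve the orientation of the edges, not the root. *)
Record rtree := RTree {
  tvertex : choiceType;
  tedge : choiceType;
  org : tedge -> tvertex;
  trm : tedge -> tvertex;
  root : tvertex;
  height : tvertex -> nat;
  joins := fun e v u => (org e = v /\ trm e = u) \/ (org e = u /\ trm e = v);
  height_root : height root = 0;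
  height_edge : forall e, height (org e) <> height (trm e);
  parent_exists : forall v, v <> root ->
    exists e u, joins e v u /\ height u < height v;
  parent_unique : forall v e u e' u', joins e v u -> joins e' v u' ->
    height u < height v -> height u' < height v -> e = e'
}.
Arguments root {r}.
Arguments org {r} _.
Arguments trm {r} _.
Arguments height {r} _.

Record tree_action (G : groupType) (T : rtree) := TreeAction {
  vact : G -> tvertex T -> tvertex T;
  eact : G -> tedge T -> tedge T;
  vact1 : forall v, vact 1 v = v;
  vactM : forall g h v, vact (g * h) v = vact g (vact h v);
  eact1 : forall e, eact 1 e = e;
  eactM : forall g h e, eact (g * h) e = eact g (eact h e);
  org_act : forall g e, org (eact g e) = vact g (org e);
  trm_act : forall g e, trm (eact g e) = vact g (trm e)
}.

Section RootedTree.
Variable T : rtree.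
Implicit Types (u v : tvertex T) (e : tedge T).

Lemma joinsC e v u : joins e v u -> joins e u v.
Proof. by case; [right|left]. Qed.

Lemma joins_edge e : joins e (org e) (trm e). Proof. by left. Qed.

Lemma joins_other e v u u' : joins e v u -> joins e v u' -> u = u'.
Proof.
have he := @height_edge T e.
by move=> [[v1 u1]|[v1 u1]] [[v2 u2]|[v2 u2]]; first [congruence|case: he; congruence].
Qed.

(** Induction on the height, that is, along the path to the root. *)
Lemma tree_ind (P : tvertex T -> Prop) : P root ->
  (forall e v u, joins e v u -> height u < height v -> P u -> P v) ->
  forall v, P v.
Proof.
move=> P0 PS v; have [n] := ubnP (height v); elim: n v => // n IHn v hv.
have [->//|/eqP /parent_exists[e [u [vu uv]]]] := eqVneq v root.
apply: (PS e v u vu uv); apply: IHn; exact: leq_trans uv _.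
Qed.

(** Simple connectedness: an arbitrary labelling of the edges by group elements
    integrates to a labelling of the vertices. *)
Lemma tree_potential (K : groupType) (c : tedge T -> K) :
  exists2 f : tvertex T -> K, f root = 1 & forall e, f (org e) * c e = f (trm e).
Proof.
pose s e v := if org e == v then (c e)^-1 else c e.
(* [pot n v k]: reading the labels along the descending path from [v], which
   has [n] edges, gives [k]. *)
pose pot := fix pot n v k := if n is n'.+1 then exists e u k',
  [/\ joins e v u, height u < height v, pot n' u k' & k = k' * s e v]
  else v = root /\ k = 1.
have pot_ex v : exists k, exists n, pot n v k.
  elim/tree_ind: v => [|e v u vu uv [k [n kn]]]; first by exists 1, 0.
  by exists (k * s e v), n.+1, e, u, k.
have pot_un n n' v k k' : pot n v k -> pot n' v k' -> k = k'.
  elim: n n' v k k' => [|n IHn] [|n'] v k k' /=.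
  - by move=> [_ ->] [_ ->].
  - by move=> [-> _] [e [u [l [_]]]]; rewrite height_root.
  - by move=> [e [u [l [_ + _ _]]]] [vr _]; rewrite vr height_root.
  - move=> [e [u [l [vu uv ul ->]]]] [e' [u' [l' [vu' uv' ul' ->]]]].
    have ee := parent_unique vu vu' uv uv'; rewrite -ee in vu' *.
    by rewrite (joins_other vu' vu) in ul'; rewrite (IHn _ _ _ _ ul ul').
have [f fP] := choice pot_ex.
have fE v n k : pot n v k -> f v = k.
  by move=> kn; have [m fm] := fP v; apply: pot_un fm kn.
have step e v u : joins e v u -> height u < height v -> f v = f u * s e v.
  by move=> vu uv; have [n un] := fP u; apply: (fE _ n.+1); exists e, u, (f u).
exists f => [|e]; first by apply: (fE _ 0).
have := @height_edge T e; case: (ltngtP (height (org e)) (height (trm e))) => // lt _.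
  rewrite (step e _ _ (joinsC (joins_edge e)) lt) /s; case: eqP => // h.
  by case: (@height_edge T e); rewrite h.
by rewrite (step e _ _ (joins_edge e) lt) /s eqxx mulgVK.
Qed.

Lemma edge_unique e e' : org e = org e' -> trm e = trm e' -> e = e'.
Proof.
move=> ho ht; have := @height_edge T e.
case: (ltngtP (height (org e)) (height (trm e))) => // lt _.
  by apply: (@parent_unique _ (trm e) e (org e) e' (org e)) => //; right.
by apply: (@parent_unique _ (org e) e (trm e) e' (trm e)) => //; left.
Qed.

End RootedTree.

(** * Fundamental domains *)

Section FundamentalDomain.
Variables (G : groupType) (T : rtree) (A : tree_action G T).
Implicit Types (g h a : G) (u v : tvertex T) (e : tedge T).

Local Notation "g ∙ v" := (vact A g v) (at level 35, right associativity).
Local Notation "g ∘ e" := (eact A g e) (at level 35, right associativity).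

Lemma vactK g v : g^-1 ∙ (g ∙ v) = v. Proof. by rewrite -vactM mulVg vact1. Qed.
Lemma vactVK g v : g ∙ (g^-1 ∙ v) = v. Proof. by rewrite -vactM mulgV vact1. Qed.
Lemma eactK g e : g^-1 ∘ (g ∘ e) = e. Proof. by rewrite -eactM mulVg eact1. Qed.

Lemma joins_act g e v u : joins e v u -> joins (g ∘ e) (g ∙ v) (g ∙ u).
Proof. by rewrite /joins org_act trm_act => -[[<- <-]|[<- <-]]; [left|right]. Qed.

(** Representatives of the vertex orbits spanning a subtree that contains the
    root, and representatives of the edge orbits starting in that subtree, and
    lying inside it whenever possible.  Thus [dgam v] carries the
    representative of [v] to [v], and [deta e] that of [e] to [e]. *)
Record fdomain := FDomain {
  dS : set (tvertex T);
  dgam : tvertex T -> G;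
  drep : tedge T -> tedge T;
  deta : tedge T -> G;
  dS_root : dS root;
  dS_parent : forall e v u, joins e v u -> height u < height v -> dS v -> dS u;
  dS_inj : forall g v, dS v -> dS (g ∙ v) -> g ∙ v = v;
  dS_gam : forall v, dS ((dgam v)^-1 ∙ v);
  dgam1 : forall v, dS v -> dgam v = 1;
  drep_act : forall g e, drep (g ∘ e) = drep e;
  deta_rep : forall e, deta e ∘ drep e = e;
  drep_org : forall e, dS (org (drep e));
  drep_trm : forall e, dS (org e) -> dS (trm e) -> dS (trm (drep e))
}.

(** A maximal set of inequivalent vertices that contains, with a vertex, the
    path from it to the root. If it missed an orbit, a vertex of that orbit
    adjacent to it could be added. *)
Lemma ex_vertex_transversal : exists S : set (tvertex T), [/\ S root,
  forall e v u, joins e v u -> height u < height v -> S v -> S u,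
  forall g v, S v -> S (g ∙ v) -> g ∙ v = v &
  forall v, exists g, S (g ∙ v)].
Proof.
pose good (S : set (tvertex T)) :=
  (forall e v u, joins e v u -> height u < height v -> S v -> S u) /\
  (forall g v, S v -> S (g ∙ v) -> g ∙ v = v).
have [F goodF totF|S [[Sp Si] Smax]] := @Zorn_bigcup _ good.
  split=> [e v u vu uv [B FB Bv]|g v [B FB Bv] [B' FB' Bgv]].
    by exists B => //; have [Bp _] := goodF B FB; apply: Bp vu uv Bv.
  have [BB'|B'B] := totF B B' FB FB'.
    by have [_ ->] := goodF B' FB' => //; apply: BB'.
  by have [_ ->] := goodF B FB => //; apply: B'B.
have add w : ~ (exists g, S (g ∙ w)) ->
    (forall e u, joins e w u -> height u < height w -> S u) -> False.
  move=> nw wp; apply: (Smax (S `|` [set w])).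
    split; first exact: subsetUl.
    by move=> /(_ w (or_intror erefl)) Sw; apply: nw; exists 1; rewrite vact1.
  split=> [e v u vu uv [Sv|vw]|g v [Sv|->] [Sgv|gvw]].
  - by left; apply: Sp vu uv Sv.
  - by left; rewrite vw in vu uv; apply: wp vu uv.
  - exact: Si.
  - by case: nw; exists g^-1; rewrite -gvw vactK.
  - by case: nw; exists g.
  - by [].
have met v : exists g, S (g ∙ v).
  elim/tree_ind: v => [|e v u vu uv [g Sgu]].
    apply: contrapT => /add; apply=> e u _; by rewrite height_root.
  apply: contrapT => nv; apply: (add (g ∙ v)).
    by move=> [h]; rewrite -vactM => Sv; apply: nv; exists (h * g).
  move=> e' u' gvu' lt'; have gvu := joins_act g vu.
  have := @height_edge T (g ∘ e).
  case: (ltngtP (height (g ∙ u)) (height (g ∙ v))) => [lt|lt|eq] ne.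
  - have ee := parent_unique gvu gvu' lt lt'; rewrite -ee in gvu'.
    by rewrite (joins_other gvu' gvu).
  - by case: nv; exists g; apply: Sp (joinsC gvu) lt Sgu.
  - by exfalso; move: gvu ne eq => [[-> ->]|[-> ->]] // ne eq; apply: ne.
exists S; split=> //.
have [g Sg] := met root; move: (g ∙ root) Sg => v.
by elim/tree_ind: v => // e v u vu uv IH /(Sp _ _ _ vu uv).
Qed.

Lemma ex_edge_transversal (P : tedge T -> Prop) : (forall e, exists g, P (g ∘ e)) ->
  exists q : tedge T -> tedge T, [/\ forall g e, q (g ∘ e) = q e,
    forall e, exists g, g ∘ q e = e & forall e, P (q e)].
Proof.
move=> exP; have [[e0 _]|noe] := pselect (exists e : tedge T, True); last first.
  by exists id; split=> [g e|e|e]; case: noe; exists e.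
have /choice[h hP] (O : set (tedge T)) : exists x, (O `&` P) !=set0 -> (O `&` P) x.
  by have [[x Ox]|] := pselect ((O `&` P) !=set0); [exists x|exists e0].
pose orb e := [set g ∘ e | g in [set: G]].
have orbP e : (orb e `&` P) (h (orb e)).
  by apply: hP; have [g Pg] := exP e; exists (g ∘ e); split=> //; exists g.
exists (fun e => h (orb e)); split=> [g e|e|e]; last by case: (orbP e).
  congr h; apply/seteqP; split=> _ [k _ <-].
    by rewrite -eactM; exists (k * g).
  by exists (k * g^-1) => //; rewrite eactM eactK.
by have [[g _ <-] _] := orbP e; exists g^-1; rewrite eactK.
Qed.

Lemma ex_fdomain : inhabited fdomain.
Proof.
have [S [S0 Sp Si Sm]] := ex_vertex_transversal.
have /choice[γ γP] v : exists g, S (g^-1 ∙ v) /\ (S v -> g = 1).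
  have [Sv|nSv] := pselect (S v); first by exists 1; rewrite invg1 vact1.
  by have [g Sg] := Sm v; exists g^-1; rewrite invgK.
pose P e := S (org e) /\ ((exists g, S (org (g ∘ e)) /\ S (trm (g ∘ e))) -> S (trm e)).
have [|q [qact qorb qP]] := @ex_edge_transversal P.
  move=> e; have [[g [So St]]|no] := pselect (exists g, S (org (g ∘ e)) /\ S (trm (g ∘ e))).
    by exists g.
  have [g Sg] := Sm (org e); exists g; split; first by rewrite org_act.
  by move=> [h]; rewrite -eactM => hP; case: no; exists (h * g).
have [η ηP] := choice qorb.
split; apply: (@FDomain S γ q η) => // [v|v|e|e So St].
- by case: (γP v).
- by case: (γP v).
- by case: (qP e).
- by have [_] := qP e; apply; exists (η e); rewrite ηP.
Qed.

Variable D : fdomain.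

Definition dvrep v := (dgam D v)^-1 ∙ v.

Lemma dvrepK v : dgam D v ∙ dvrep v = v. Proof. exact: vactVK. Qed.

Lemma dvrep_id v : dS D v -> dvrep v = v.
Proof. by move=> Sv; rewrite /dvrep dgam1 // invg1 vact1. Qed.

Lemma dS_vrep v : dS D (dvrep v). Proof. exact: dS_gam. Qed.

Lemma dS_eq g v u : dS D v -> dS D u -> g ∙ v = u -> v = u.
Proof. by move=> Sv Su gvu; rewrite -gvu (dS_inj (f := D)) // gvu. Qed.

Lemma dvrep_act g v : dvrep (g ∙ v) = dvrep v.
Proof.
apply/esym/(@dS_eq ((dgam D (g ∙ v))^-1 * g * dgam D v)); try exact: dS_vrep.
by rewrite !vactM dvrepK.
Qed.

Lemma drepK e : drep D (drep D e) = drep D e.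
Proof. by rewrite -(drep_act D (deta D e) (drep D e)) deta_rep. Qed.

Lemma org_drep e : org (drep D e) = dvrep (org e).
Proof.
rewrite -{2}(deta_rep D e) org_act dvrep_act dvrep_id //; exact: drep_org.
Qed.

Lemma dvrep_trm e : dvrep (trm (drep D e)) = dvrep (trm e).
Proof. by rewrite -{2}(deta_rep D e) trm_act dvrep_act. Qed.

(** The ends of the representative are equivalent to those of [e] and lie in the
    transversal, hence coincide with them; and a tree has no multiple edges. *)
Lemma drep_inside e : dS D (org e) -> dS D (trm e) -> drep D e = e.
Proof.
move=> So St; apply: edge_unique; first by rewrite org_drep dvrep_id.
by rewrite -[LHS]dvrep_id; [rewrite dvrep_trm dvrep_id|apply: drep_trm].
Qed.

(** The image of this element in the fundamental group is the generator of the
    edge: it closes the lift of [e] up to the representative of its end. *)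
Definition dtau e := dgam D (trm e).

Lemma dtau1 e : dS D (trm e) -> dtau e = 1.
Proof. exact: dgam1. Qed.

(** Walking along the tree, any vertex can be moved into the domain by these
    elements; applied to a translate of the root, this determines an element up
    to a stabilizer. *)
Lemma domain_generates (H : set G) : is_subgroup H ->
  (forall v a, dS D v -> a ∙ v = v -> H a) ->
  (forall e, drep D e = e -> H (dtau e)) -> H = [set: G].
Proof.
move=> [H1' HB'] Hst Hτ.
have H1 : H 1 by rewrite -in_setE.
have HB a b : H a -> H b -> H (a * b^-1).
  by move=> Ha Hb; rewrite -in_setE; apply: HB'; rewrite in_setE.
have HV a : H a -> H a^-1 by rewrite -[a^-1]mul1g; apply: HB.
have HM a b : H a -> H b -> H (a * b) by rewrite -{2}[b]invgK => Ha /HV; apply: HB.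
have cover v : exists2 h, H h & dS D (h ∙ v).
  elim/tree_ind: v => [|e v u vu _ [h Hh Su]].
    by exists 1; rewrite ?vact1 //; apply: dS_root.
  have {vu} := joins_act h vu; move: (h ∘ e) (h ∙ u) Su => {}e {}u Su vu.
  suff [k Hk Sk] : exists2 k, H k & dS D (k ∙ h ∙ v).
    by exists (k * h); [apply: HM|rewrite vactM].
  have Sq := drep_org D e; have eq := deta_rep D e.
  have Hq : H (dtau (drep D e)) by apply: Hτ; rewrite drepK.
  case: vu => [[<- tu]|[ou <-]].
    have Hη : H (deta D e * dtau (drep D e)).
      apply: (Hst u) => //.
      have {1}-> : u = dvrep (trm (drep D e)) by rewrite dvrep_trm tu dvrep_id.
      by rewrite vactM dvrepK -trm_act eq.
    exists (deta D e)^-1; last by rewrite -{2}eq org_act vactK.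
    by apply: HV; rewrite -[deta D e](mulgK (dtau (drep D e))); apply: HB.
  have Hη : H (deta D e).
    apply: (Hst u) => //; have {1}-> : u = org (drep D e) by rewrite org_drep ou dvrep_id.
    by rewrite -org_act eq.
  exists (deta D e * dtau (drep D e))^-1; first by apply/HV/HM.
  by rewrite invgM vactM -{3}eq trm_act vactK; apply: dS_vrep.
apply/seteqP; split=> // g _; have [h Hh Shg] := cover (g ∙ root).
rewrite -vactM in Shg; have hg := dS_inj (dS_root D) Shg.
by rewrite -(mulKg h g); apply: HM; [apply: HV|apply: Hst hg; apply: dS_root].
Qed.

(** Homomorphisms out of [G]: compatible data on vertex stabilizers and edges
    of the fundamental domain extend, up to conjugation by [f]. *)
Section Extension.
Variables (K : groupType) (φ : tvertex T -> G -> K) (κ : tedge T -> K).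
Hypothesis φM : forall v a b, dS D v -> a ∙ v = v -> b ∙ v = v ->
  φ v (a * b) = φ v a * φ v b.
Hypothesis φκ : forall e a, drep D e = e -> a ∘ e = e ->
  φ (org e) a * κ e = κ e * φ (dvrep (trm e)) ((dtau e)^-1 * a * dtau e).

Let φ1 v : dS D v -> φ v 1 = 1.
Proof.
move=> Sv; apply: (@mulgI _ (φ v 1)); rewrite -φM ?vact1 //.
by rewrite !mulg1.
Qed.

(* Transport along an edge: [κ] of its representative, corrected at both ends
   by the stabilizer elements that measure the choice of translates. *)
Let c e := let q := drep D e in
  φ (org q) ((dgam D (org e))^-1 * deta D e) * κ q *
  φ (dvrep (trm q)) ((dtau q)^-1 * (deta D e)^-1 * dgam D (trm e)).

(* The element of the vertex group measuring by how much [g] fails to respect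
   the chosen translates of the representative of [v]. *)
Let lam g v := φ (dvrep v) ((dgam D (g ∙ v))^-1 * g * dgam D v).

Let fix_lam g v : ((dgam D (g ∙ v))^-1 * g * dgam D v) ∙ dvrep v = dvrep v.
Proof. by rewrite !vactM dvrepK -/(dvrep _) dvrep_act. Qed.

Let lamM g h v : lam (g * h) v = lam g (h ∙ v) * lam h v.
Proof.
rewrite /lam dvrep_act -φM; first by rewrite vactM !mulgA mulgK.
- exact: dS_vrep.
- by rewrite -(dvrep_act h v) fix_lam.
- exact: fix_lam.
Qed.

Let transport g e : lam g (org e) * c e = c (g ∘ e) * lam g (trm e).
Proof.
rewrite /lam /c drep_act org_act trm_act -org_drep -(dvrep_trm e).
set q := drep D e; set η := deta D e; set η' := deta D (g ∘ e).
have eq : η ∘ q = e by apply: deta_rep.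
have eq' : η' ∘ q = g ∘ e by rewrite /η' /q -(drep_act D g e) deta_rep.
have Sq : dS D (org q) by apply: drep_org.
have St : dS D (dvrep (trm q)) by apply: dS_vrep.
pose a := η'^-1 * g * η.
have aq : a ∘ q = q by rewrite !eactM eq -eq' eactK.
have oE : dvrep (org e) = org q by rewrite org_drep.
have ogE : dvrep (g ∙ org e) = org q by rewrite dvrep_act.
have tE : dvrep (trm e) = dvrep (trm q) by rewrite dvrep_trm.
have tgE : dvrep (g ∙ trm e) = dvrep (trm q) by rewrite dvrep_act.
have f1 : ((dgam D (g ∙ org e))^-1 * η') ∙ org q = org q.
  by rewrite vactM -(org_act A η') eq' org_act; exact: ogE.
have f2 : ((dgam D (org e))^-1 * η) ∙ org q = org q.
  by rewrite vactM -(org_act A η) eq; exact: oE.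
have f3 : ((dgam D (g ∙ org e))^-1 * g * dgam D (org e)) ∙ org q = org q.
  by rewrite -oE fix_lam.
have f4 : ((dtau q)^-1 * η^-1 * dgam D (trm e)) ∙ dvrep (trm q) = dvrep (trm q).
  by rewrite -{1}tE !vactM dvrepK -eq trm_act vactK.
have f5 : ((dtau q)^-1 * η'^-1 * dgam D (g ∙ trm e)) ∙ dvrep (trm q) = dvrep (trm q).
  by rewrite -{1}tgE !vactM dvrepK -(trm_act A g) -eq' trm_act vactK.
have f6 : ((dgam D (g ∙ trm e))^-1 * g * dgam D (trm e)) ∙ dvrep (trm q) = dvrep (trm q).
  by rewrite -tE fix_lam.
have f7 : ((dtau q)^-1 * a * dtau q) ∙ dvrep (trm q) = dvrep (trm q).
  by rewrite -mulgA 2!vactM dvrepK -(trm_act A a) aq.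
have f8 : a ∙ org q = org q by rewrite -org_act aq.
rewrite [LHS]mulgA [X in X * _ = _]mulgA -(φM Sq f3 f2).
rewrite -[RHS]mulgA -(φM St f5 f6).
rewrite (_ : _ * (_ * η) = (dgam D (g ∙ org e))^-1 * η' * a); last first.
  by rewrite /a !mulgA !mulgK.
rewrite (φM Sq f1 f8) -[X in X * _ = _]mulgA (φκ (drepK e) aq).
rewrite [X in X * _ = _]mulgA -[LHS]mulgA -(φM St f7 f4).
by congr (_ * φ _ _); rewrite /a !mulgA !mulgK.
Qed.

Theorem hom_extension : exists (Φ : G -> K) (f : tvertex T -> K), [/\
  forall g h, Φ (g * h) = Φ g * Φ h,
  forall v a, dS D v -> a ∙ v = v -> Φ a * f v = f v * φ v a,
  forall e, drep D e = e -> Φ (dtau e) * f (dvrep (trm e)) = f (org e) * κ e &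
  (forall e, drep D e = e -> dS D (trm e) -> κ e = 1) -> forall v, dS D v -> f v = 1].
Proof.
have [f f1 fc] := tree_potential c.
pose Φ g := f (g ∙ root) * lam g root.
have key g v : Φ g * f v = f (g ∙ v) * lam g v.
  elim/tree_ind: v => [|e v u [[<- <-]|[<- <-]] _ IH].
  - by rewrite f1 mulg1.
  - apply: (@mulIg _ (c e)); rewrite -[LHS]mulgA fc IH -[RHS]mulgA transport.
    by rewrite [RHS]mulgA -(org_act A) fc trm_act.
  - by rewrite -fc mulgA IH -mulgA transport mulgA -org_act fc trm_act.
have ck e : drep D e = e -> c e = κ e.
  move=> eq; have St : dS D (dvrep (trm e)) by apply: dS_vrep.
  have So : dS D (org e) by rewrite -eq; apply: drep_org.
  have ηe : deta D e ∘ e = e by have := deta_rep D e; rewrite eq.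
  have ηt : ((dtau e)^-1 * deta D e * dtau e) ∙ dvrep (trm e) = dvrep (trm e).
    by rewrite !vactM dvrepK -trm_act ηe.
  rewrite /c eq dgam1 // invg1 mul1g φκ // -mulgA -φM //.
    by rewrite -/(dtau e) !mulgA !mulgK mulVg φ1 // mulg1.
  by rewrite !vactM dvrepK -[X in _ ∙ _ ∙ trm X]ηe trm_act vactK.
exists Φ, f; split=> [g h|v a Sv av|e eq|κ1 v].
- have := key (g * h) root; rewrite f1 mulg1 => ->.
  by rewrite lamM mulgA vactM -key -mulgA -key f1 mulg1.
- by rewrite key av /lam av dvrep_id // dgam1 // invg1 mul1g mulg1.
- rewrite key dvrepK -ck // /lam dvrepK (dvrep_id (dS_vrep _)).
  by rewrite mulVg mul1g dgam1 ?φ1 ?mulg1 ?fc //; apply: dS_vrep.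
- elim/tree_ind: v => [//|e v u vu uv IH Sv].
  have Su := dS_parent vu uv Sv.
  have [So St] : dS D (org e) /\ dS D (trm e) by case: vu => -[-> ->].
  have eq := drep_inside So St.
  have := fc e; rewrite ck // κ1 // mulg1.
  by case: vu => [[-> ->] ->|[-> ->] <-]; rewrite IH.
Qed.

End Extension.

End FundamentalDomain.

(** * Subgroups and presented groups *)

Lemma is_subgroupP (G : groupType) (H : set G) :
  H 1 -> (forall a b, H a -> H b -> H (a * b)) -> (forall a, H a -> H a^-1) ->
  is_subgroup H.
Proof.
move=> H1 HM HV; split; first by rewrite in_setE.
by move=> a b; rewrite !in_setE => Ha Hb; apply: HM => //; apply: HV.
Qed.

Section Subgroup.
Variables (G : groupType) (H : set G) (sH : is_subgroup H).

Lemma subgroup1 : H 1. Proof. by case: sH; rewrite in_setE. Qed.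

Lemma subgroupF a b : H a -> H b -> H (a / b).
Proof. by case: sH => _ HB Ha Hb; rewrite -in_setE; apply: HB; rewrite in_setE. Qed.

Lemma subgroupV a : H a -> H a^-1.
Proof. by rewrite -[a^-1]mul1g; apply: subgroupF; apply: subgroup1. Qed.

Lemma subgroupM a b : H a -> H b -> H (a * b).
Proof. by move=> Ha Hb; rewrite -[b]invgK; apply: subgroupF => //; apply: subgroupV. Qed.

Definition subgroup_type (_ : is_subgroup H) : Type := {g : G | g \in H}.
Local Notation S := (subgroup_type sH).
HB.instance Definition _ := [isSub of S for @sval _ _].
HB.instance Definition _ := [Choice of S by <:].

Lemma sub_in (a : S) : H (val a). Proof. by rewrite -in_setE; apply: valP. Qed.

Definition sub_one : S := Sub 1 (mem_set subgroup1).
Definition sub_mul (a b : S) : S := Sub (val a * val b) (mem_set (subgroupM (sub_in a) (sub_in b))).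
Definition sub_inv (a : S) : S := Sub (val a)^-1 (mem_set (subgroupV (sub_in a))).

Fact sub_mulA : associative sub_mul.
Proof. by move=> a b c; apply: val_inj; rewrite !SubK mulgA. Qed.
Fact sub_mul1 : left_id sub_one sub_mul.
Proof. by move=> a; apply: val_inj; rewrite !SubK mul1g. Qed.
Fact sub_mulr1 : right_id sub_one sub_mul.
Proof. by move=> a; apply: val_inj; rewrite !SubK mulg1. Qed.
Fact sub_mulV : left_inverse sub_one sub_inv sub_mul.
Proof. by move=> a; apply: val_inj; rewrite !SubK mulVg. Qed.
Fact sub_mulrV : right_inverse sub_one sub_inv sub_mul.
Proof. by move=> a; apply: val_inj; rewrite !SubK mulgV. Qed.

HB.instance Definition _ := isGroup.Build S
  sub_mulA sub_mul1 sub_mulr1 sub_mulV sub_mulrV.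

Lemma val_subM (a b : S) : val (a * b) = val a * val b. Proof. by []. Qed.
Lemma val_sub1 : val (1 : S) = 1. Proof. by []. Qed.
Lemma val_subV (a : S) : val a^-1 = (val a)^-1. Proof. by []. Qed.

(** Made total, so that elements can be moved between subgroups that depend on a
    vertex without transporting proofs. *)
Definition to_sub (g : G) : S := insubd (1 : S) g.

Lemma to_subK g : H g -> val (to_sub g) = g.
Proof. by move=> Hg; rewrite insubdK //; apply: mem_set. Qed.

Lemma to_sub_val (a : S) : to_sub (val a) = a. Proof. exact: valKd. Qed.

Lemma to_subM g h : H g -> H h -> to_sub (g * h) = to_sub g * to_sub h.
Proof.
move=> Hg Hh; apply: val_inj.
by rewrite to_subK ?val_subM ?to_subK //; apply: subgroupM.
Qed.

End Subgroup.

Section HomOut.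
Variables (G K : groupType) (f : G -> K).
Hypothesis fM : forall a b, f (a * b) = f a * f b.

Lemma hom1 : f 1 = 1.
Proof. by apply: (@mulgI _ (f 1)); rewrite -fM !mulg1. Qed.

Lemma homV a : f a^-1 = (f a)^-1.
Proof. by apply/esym/mulg1_eq; rewrite -fM mulgV hom1. Qed.

End HomOut.

Section PresentedHom.
Variables (X : choiceType) (R : word X -> word X -> Prop).
Local Notation P := (presented R).

Definition pgen (x : X) : P := pres_class R [:: gen x].

Lemma pres_classM (u v : word X) :
  pres_class R (u ++ v) = pres_class R u * pres_class R v.
Proof. by rewrite -[RHS]/(pres_mul _ _) pres_mulE. Qed.

Lemma pres_class2 x y :
  pres_class R [:: gen x; gen y] = pgen x * pgen y.
Proof. exact: (pres_classM [:: _] [:: _]). Qed.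

Lemma pres_class3 x y z :
  pres_class R [:: gen x; gen y; gen z] = pgen x * (pgen y * pgen z).
Proof. by rewrite -pres_class2; exact: (pres_classM [:: _] [:: _; _]). Qed.

Lemma pres_class_nil : pres_class R [::] = 1. Proof. by []. Qed.

Lemma pres_classV x : pres_class R [:: (x, true)] = (pgen x)^-1.
Proof.
apply/esym/mulg1_eq; rewrite -pres_classM -pres_class_nil.
by apply/eqP/pres_classP/(@pres_cancel _ _ x false).
Qed.

Lemma pres_class_rel u v : R u v -> pres_class R u = pres_class R v.
Proof. by move=> Ruv; apply/eqP/pres_classP/pres_rel. Qed.

Variable K : groupType.

(** A homomorphism from a presented group is determined on the generators. *)
Lemma pres_ext (f g : P -> K) : (forall a b, f (a * b) = f a * f b) ->
  (forall a b, g (a * b) = g a * g b) -> (forall x, f (pgen x) = g (pgen x)) ->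
  forall a, f a = g a.
Proof.
move=> fM gM fg a; rewrite -(pres_class_repr a).
elim: (repr a) => [|[x b] w IHw]; first by rewrite pres_class_nil !hom1.
rewrite -cat1s pres_classM fM gM IHw; congr (_ * _).
by case: b; rewrite ?pres_classV ?homV // fg.
Qed.

Variable h : X -> K.

Fixpoint word_val (w : word X) : K :=
  if w is (x, b) :: w' then (if b then (h x)^-1 else h x) * word_val w' else 1.

Lemma word_val_cat u v : word_val (u ++ v) = word_val u * word_val v.
Proof. by elim: u => [|[x b] u /= ->]; rewrite ?mul1g ?mulgA. Qed.

Hypothesis hR : forall u v, R u v -> word_val u = word_val v.

Lemma word_val_eq u v : pres_eq R u v -> word_val u = word_val v.
Proof.
elim=> //= [u1 u2 u3 _ -> _ -> //|u1 u2 v1 v2 _ eu _ ev|x b].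
  by rewrite !word_val_cat eu ev.
by case: b; rewrite /= mulg1 ?mulVg ?mulgV.
Qed.

Definition pres_hom (a : P) : K := word_val (repr a).

Lemma pres_hom_class w : pres_hom (pres_class R w) = word_val w.
Proof. exact/word_val_eq/repr_pres_class. Qed.

Lemma pres_homM a b : pres_hom (a * b) = pres_hom a * pres_hom b.
Proof.
by rewrite -[a * b]/(pres_mul a b) /pres_mul pres_hom_class word_val_cat.
Qed.

Lemma pres_hom_gen x : pres_hom (pgen x) = h x.
Proof. by rewrite pres_hom_class /= mulg1. Qed.

End PresentedHom.

Lemma isomorphism (G H : groupType) (f : G -> H) (g : H -> G) :
  (forall a b, f (a * b) = f a * f b) -> cancel f g -> cancel g f ->
  isomorphic G H.
Proof.
move=> fM fg gf.
pose F : {multiplicative G -> H} := HB.pack f (isMultiplicative.Build G H f fM).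
by exists F; exists g.
Qed.

(** * The quotient graph of groups *)

Section QuotientGraph.
Variables (G : groupType) (T : rtree) (A : tree_action G T) (D : fdomain A).

Local Notation "g ∙ v" := (vact A g v) (at level 35, right associativity).
Local Notation "g ∘ e" := (eact A g e) (at level 35, right associativity).

Definition vstab v : set G := [set a | a ∙ v = v].

Lemma vstab_subgroup v : is_subgroup (vstab v).
Proof.
apply: is_subgroupP => [|a b av bv|a av]; rewrite /vstab /=.
- exact: vact1.
- by rewrite vactM bv.
- by rewrite -{1}av vactK.
Qed.

Definition qvertex := {v : tvertex T | v \in dS D}.
Definition qrep := {e : tedge T | drep D e == e}.
Definition qedge := (qrep * bool)%type.

Definition qroot : qvertex := exist _ root (mem_set (dS_root D)).
Definition to_qvertex v : qvertex := insubd qroot v.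

Lemma to_qvertexK v : dS D v -> val (to_qvertex v) = v.
Proof. by move=> Sv; rewrite insubdK //; apply: mem_set. Qed.

Lemma qvertex_in (P : qvertex) : dS D (val P).
Proof. by rewrite -in_setE; apply: valP. Qed.

Lemma qrepK (e : qrep) : drep D (val e) = val e.
Proof. exact/eqP/(valP e). Qed.

Lemma qrep_org (e : qrep) : dS D (org (val e)).
Proof. by rewrite -qrepK; apply: drep_org. Qed.

Definition qsrc (y : qedge) : qvertex :=
  to_qvertex (if y.2 then dvrep D (trm (val y.1)) else org (val y.1)).
Definition qbar (y : qedge) : qedge := (y.1, ~~ y.2).

Fact qbarK : involutive qbar. Proof. by case=> e []. Qed.
Fact qbar_neq y : qbar y != y. Proof. by case: y => e []; apply/eqP => -[]. Qed.

Definition quotient_mgraph : mgraph := @MGraph qvertex qedge qsrc qbar qbarK qbar_neq.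
Local Notation Y := quotient_mgraph.

Lemma qsrc_val (y : medge Y) :
  val (src y) = if y.2 then dvrep D (trm (val y.1)) else org (val y.1).
Proof.
by rewrite /src /= /qsrc to_qvertexK //; case: y.2; [apply: dS_vrep|apply: qrep_org].
Qed.

(** The edges whose representative lies inside the transversal of the vertices,
    which spans a subtree. *)
Definition qtree : set (medge Y) := [set y | dS D (trm (val y.1))].

Lemma qtree_joins y : qtree y -> joins (val y.1) (val (src y)) (val (tgt y)).
Proof.
rewrite /tgt !qsrc_val /=; case: y => e [] Ty /=; rewrite dvrep_id //; by [right|left].
Qed.

Lemma walk_cat (P Q R : Y) p q : walk P p Q -> walk Q q R -> walk P (p ++ q) R.
Proof.
by elim: p P => [|y p IHp] P /= => [/eqP->//|/andP[-> pQ] qR]; rewrite IHp.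
Qed.

Lemma qtree_connected : connected_by qtree.
Proof.
pose conn (P Q : Y) := exists2 p : seq (medge Y), walk P p Q & [set` p] `<=` qtree.
have trans P Q R : conn P Q -> conn Q R -> conn P R.
  move=> [p pP pT] [q qQ qT]; exists (p ++ q); first exact: walk_cat qQ.
  by move=> y /=; rewrite mem_cat => /orP[/pT|/qT].
have step y : qtree y -> conn (src y) (tgt y).
  by move=> Ty; exists [:: y]; rewrite /= ?eqxx // => z; rewrite /= inE => /eqP->.
have toroot v : dS D v -> conn (to_qvertex v) qroot /\ conn qroot (to_qvertex v).
  elim/tree_ind: v => [|e v u vu uv IH] Sv.
    rewrite (_ : to_qvertex root = qroot) //; last first.
      by apply: val_inj; rewrite to_qvertexK.
    by split; exists [::] => //=.
  have Su := dS_parent vu uv Sv; have [u0 u1] := IH Su.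
  have [So St] : dS D (org e) /\ dS D (trm e) by case: vu => -[-> ->].
  have eq : drep D e == e by rewrite drep_inside.
  pose y b : medge Y := (exist (fun e => drep D e == e) e eq, b).
  have s1 := step (y true) St; have s2 := step (y false) St.
  rewrite /tgt /= /qsrc /= dvrep_id // in s1 s2.
  by case: vu s1 s2 => -[-> ->] s1 s2; split;
    [apply: trans u0|apply: trans u1 _|apply: trans u0|apply: trans u1 _].
move=> P Q; have [P0 _] := toroot _ (qvertex_in P).
have [_ Q0] := toroot _ (qvertex_in Q); move: P0 Q0.
by rewrite /to_qvertex !valKd; apply: trans.
Qed.

(** A highest vertex of a circuit would have two different edges leading
    down. *)
Lemma qtree_spanning : spanning_tree qtree.
Proof.
split=> [y //||c cT]; first exact: qtree_connected.
apply/negP => /and3P[c0 cc _].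
have [z zc zmax] := ex_maximum_seq (fun y : medge Y => height (val (src y))) c0.
have := prev_cycle cc zc; have := next_cycle cc zc.
set y := prev c z; set x := next c z => /andP[/eqP zx _] /andP[/eqP yz zy].
have yc : y \in c by rewrite mem_prev.
have xc : x \in c by rewrite mem_next.
have jy := qtree_joins (cT _ yc); have jz := qtree_joins (cT _ zc).
have hne e (v u : tvertex T) : joins e v u -> height u <> height v.
  by have he := @height_edge T e; move=> [[<- <-]|[<- <-]] h; apply: he.
have ly : height (val (src y)) < height (val (src z)).
  have := zmax _ yc; rewrite leq_eqVlt => /orP[/eqP h|//].
  by rewrite -yz in h; case: (hne _ _ _ (joinsC jy)).
have lx : height (val (tgt z)) < height (val (src z)).
  have := zmax _ xc; rewrite leq_eqVlt -zx => /orP[/eqP h|//].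
  by case: (hne _ _ _ jz).
rewrite yz in jy; have := parent_unique (joinsC jy) jz ly lx.
move=> /val_inj e1.
have pairE (a b : medge Y) : a.1 = b.1 -> a.2 = b.2 -> a = b.
  by case: a b => ? ? [? ?] /= -> ->.
case: (eqVneq y.2 z.2) => [e2|ne2]; first by move: ly; rewrite (pairE _ _ e1 e2) ltnn.
case/eqP: zy; apply: pairE => //=.
by case: (y.2) (z.2) ne2 => [] [].
Qed.

Lemma quotient_connected : connected_mgraph Y.
Proof.
split; first by exists qroot.
by move=> P Q; have [p pP _] := qtree_connected P Q; exists p.
Qed.


Definition qgroup (P : Y) : groupType := subgroup_type (vstab_subgroup (val P)).

Definition qegroup (y : medge Y) : set (qgroup (src y)) :=
  [set a | (if y.2 then dtau D (val y.1) * val a * (dtau D (val y.1))^-1 else val a)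
             ∘ val y.1 = val y.1].

Definition qconj (y : medge Y) (g : G) : G :=
  if y.2 then dtau D (val y.1) * g * (dtau D (val y.1))^-1
  else (dtau D (val y.1))^-1 * g * dtau D (val y.1).

Definition qtrans (y : medge Y) (a : qgroup (src y)) : qgroup (src (ebar y)) :=
  to_sub _ (qconj y (val a)).

Lemma qconj_stab (y : medge Y) (a : qgroup (src y)) :
  qegroup a -> vstab (val (src (ebar y))) (qconj y (val a)).
Proof.
rewrite qsrc_val /vstab /qegroup /qconj /=; case: y a => e [] a /= ae.
  by rewrite -org_act ae.
by rewrite !vactM dvrepK -trm_act ae.
Qed.

Lemma qtrans_val (y : medge Y) (a : qgroup (src y)) :
  qegroup a -> val (qtrans a) = qconj y (val a).
Proof. by move=> ae; rewrite to_subK //; apply: qconj_stab. Qed.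

Lemma qegroup_subgroup y : is_subgroup (@qegroup y).
Proof.
apply: is_subgroupP => [|a b|a]; rewrite /qegroup /mkset.
- rewrite val_sub1; by case: y.2; rewrite ?mulg1 ?mulgV eact1.
- rewrite val_subM => ae be.
  suff -> : (if y.2 then dtau D (val y.1) * (val a * val b) / dtau D (val y.1)
             else val a * val b) =
     (if y.2 then dtau D (val y.1) * val a / dtau D (val y.1) else val a) *
     (if y.2 then dtau D (val y.1) * val b / dtau D (val y.1) else val b).
    by rewrite eactM be.
  by case: y.2; rewrite // !mulgA mulgVK.
- rewrite val_subV => ae; rewrite -[X in _ ∘ X = _]ae.
  suff -> : (if y.2 then dtau D (val y.1) * (val a)^-1 / dtau D (val y.1)
             else (val a)^-1) =
     (if y.2 then dtau D (val y.1) * val a / dtau D (val y.1) else val a)^-1.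
    exact: eactK.
  by case: y.2; rewrite // !invgM invgK mulgA.
Qed.

Lemma qtrans_egroup y a : @qegroup y a -> @qegroup (ebar y) (qtrans a).
Proof.
move=> ae; rewrite /qegroup /= qtrans_val //; move: ae; rewrite /qegroup /qconj /=.
by case: y.2 => //= ?; rewrite !mulgA mulgV mul1g mulgK.
Qed.

Lemma qtransM y a b : @qegroup y a -> @qegroup y b ->
  qtrans (a * b) = qtrans a * qtrans b.
Proof.
move=> ae be; rewrite /qtrans -to_subM; try exact: qconj_stab.
by congr to_sub; rewrite /qconj val_subM; case: y.2; rewrite !mulgA ?mulgVK ?mulgK.
Qed.

Lemma qtransK y a : @qegroup y a ->
  Tagged qgroup (qtrans (qtrans a)) = Tagged qgroup a.
Proof.
move=> ae; have be := qtrans_egroup ae.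
have := qtrans_val be; rewrite (qtrans_val ae); move: (qtrans (qtrans a)).
case: y a ae be => e b a ae be; case: b a ae be => a ae be a2 ea2.
  congr Tagged; apply: val_inj; rewrite ea2 /qconj /=.
  by rewrite !mulgA mulVg mul1g mulgVK.
congr Tagged; apply: val_inj; rewrite ea2 /qconj /=.
by rewrite !mulgA mulgV mul1g mulgK.
Qed.

Definition quotient_gog : graph_of_groups :=
  GraphOfGroups quotient_connected qegroup_subgroup qtrans_egroup qtransM qtransK.

(** * The group as a fundamental group *)

Local Notation π := (pi1 (qtree : set (medge quotient_gog))).
Local Notation R := (@pi1_rel quotient_gog qtree).

Definition vclass (P : quotient_gog) (g : G) : π :=
  pgen R (inl (Tagged (@vgroup quotient_gog) (to_sub (vstab_subgroup (val P)) g))).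

Definition eclass (e : tedge T) : π :=
  if insub e is Some e' then pgen R (inr ((e' : qrep), false)) else 1.

Lemma vclassM (P : quotient_gog) g h :
  vstab (val P) g -> vstab (val P) h -> vclass P (g * h) = vclass P g * vclass P h.
Proof.
move=> Pg Ph; rewrite /vclass to_subM // /pgen -pres_classM.
by apply/esym/pres_class_rel/pi1_mul.
Qed.

Lemma pgen_bar (y : medge quotient_gog) :
  pgen R (inr (ebar y)) = (pgen R (inr y))^-1.
Proof.
apply/esym/mulg1_eq; rewrite -{1}(ebarK y) /pgen -pres_classM.
exact/pres_class_rel/pi1_bar.
Qed.

Lemma eclass_rep (e : qrep) : eclass (val e) = pgen R (inr (e, false)).
Proof. by rewrite /eclass valK. Qed.

Definition gen_val (x : pi1_gen quotient_gog) : G :=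
  match x with
  | inl a => val (tagged a)
  | inr y => if y.2 then (dtau D (val y.1))^-1 else dtau D (val y.1)
  end.

Lemma gen_val_rel u v : R u v -> word_val gen_val u = word_val gen_val v.
Proof.
case=> [P a b|[e b]|[e b] a ae|[e b] Ty] /=; rewrite ?mulg1 //.
- by case: b; rewrite /= ?mulVg ?mulgV.
- rewrite [RHS](qtrans_val ae) /qconj.
  by case: b a ae => a ae /=; rewrite mulgA.
- by rewrite dtau1 // invg1; case: b Ty.
Qed.

(** The two homomorphisms given by the extension theorem and by the presentation
    are inverse to each other, since they are so on generators. *)
Theorem quotient_gog_pi1 : is_fundamental_group quotient_gog G.
Proof.
exists qtree; first exact: qtree_spanning.
have [||Φ [f [ΦM Φv Φe f1]]] := @hom_extension G T A D π (fun v => vclass (to_qvertex v)) eclass.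
- by move=> v a b Sv av bv; apply: vclassM; rewrite to_qvertexK.
- move=> e a eq ae; pose e' : qrep := exist (fun e => drep D e == e) e (introT eqP eq).
  rewrite -[e]/(val e') eclass_rep.
  pose y : medge quotient_gog := (e', false).
  have Pa : vstab (val (src y)) a by rewrite qsrc_val /vstab /= -org_act ae.
  pose b : vgroup (src y) := to_sub _ a.
  have bE : val b = a by apply: to_subK.
  have be : egroup y b by rewrite /egroup /= /qegroup /= bE.
  have h : pgen R (inr (ebar y)) * (vclass (src y) a * pgen R (inr y)) =
      pgen R (inl (Tagged (@vgroup quotient_gog) (Defs.etrans y b))).
    have := pres_class_rel (@pi1_conj quotient_gog qtree y b be).
    by rewrite pres_class3.
  rewrite pgen_bar in h; rewrite -[LHS](mulVKg (pgen R (inr y))) h.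
  by rewrite /vclass /Defs.etrans /= /qtrans /qconj /= bE.
have fS v : dS D v -> f v = 1.
  apply: f1 => {}v eq Sv.
  pose e' : qrep := exist (fun e => drep D e == e) v (introT eqP eq).
  rewrite -[v]/(val e') eclass_rep.
  by apply: (@pres_class_rel _ R _ [::]); apply: pi1_tree.
have ΦS v a : dS D v -> a ∙ v = v -> Φ a = vclass (to_qvertex v) a.
  by move=> Sv av; have := Φv v a Sv av; rewrite fS // mulg1 mul1g.
have Φτ e : drep D e = e -> Φ (dtau D e) = eclass e.
  move=> eq; have := Φe e eq; rewrite !fS ?mulg1 ?mul1g //; last exact: dS_vrep.
  by rewrite -eq; apply: drep_org.
pose Ψ := pres_hom (R := R) gen_val.
have ΨM : forall a b, Ψ (a * b) = Ψ a * Ψ b := pres_homM gen_val_rel.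
apply: (@isomorphism _ _ Φ Ψ ΦM) => [g|].
  pose H := [set g | Ψ (Φ g) = g].
  suff HT : H = [set: G] by have : [set: G] g by []; rewrite -HT.
  apply: (@domain_generates _ _ _ D); first apply: is_subgroupP => [|a b|a]; rewrite /H /=.
  - by rewrite (hom1 ΦM) (hom1 ΨM).
  - by rewrite ΦM ΨM => -> ->.
  - by rewrite (homV ΦM) (homV ΨM) => ->.
  - move=> v a Sv av; rewrite (ΦS v) // /vclass /Ψ (pres_hom_gen gen_val_rel) /=.
    by rewrite to_subK // to_qvertexK.
  - move=> e eq; pose e' : qrep := exist (fun e => drep D e == e) e (introT eqP eq).
    by rewrite Φτ // -[e]/(val e') eclass_rep /Ψ (pres_hom_gen gen_val_rel).
apply: (@pres_ext _ _ _ (fun a => Φ (Ψ a)) id) => // [a b|x].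
  by rewrite ΨM ΦM.
rewrite /Ψ (pres_hom_gen gen_val_rel); case: x => [[P a]|[e b]] /=.
  have Pa : vstab (val P) (val a) := sub_in a.
  rewrite (ΦS (val P)) //; last exact: qvertex_in.
  have -> : to_qvertex (val P) = P by rewrite /to_qvertex valKd.
  by rewrite /vclass to_sub_val.
case: b; last by rewrite Φτ ?eclass_rep // qrepK.
by rewrite (homV ΦM) Φτ ?eclass_rep ?qrepK // -pgen_bar.
Qed.

(** * Free actions on trees *)

Definition outer_edge := {e : tedge T | (drep D e == e) && `[< ~ dS D (trm e) >]}.

(** With trivial stabilizers the data of the extension theorem amount to
    arbitrary values on the edges leaving the transversal, which is the
    universal property of the free group on them. *)
Theorem free_action_free : (forall v g, g ∙ v = v -> g = 1) ->
  exists2 F : {multiplicative free_group outer_edge -> G}, injective F &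
    forall g, exists a, F a = g.
Proof.
move=> Afree; pose R0 (_ _ : word outer_edge) := False.
pose κ e : free_group outer_edge :=
  if insub e is Some x then pgen R0 (x : outer_edge) else 1.
have [||Φ [f [ΦM Φv Φe f1]]] := @hom_extension G T A D (free_group outer_edge) (fun _ _ => 1) κ.
- by move=> *; rewrite mulg1.
- by move=> *; rewrite mulg1 mul1g.
have fS v : dS D v -> f v = 1.
  apply: f1 => {}v eq Sv; rewrite /κ insubF //.
  by apply/negbTE; rewrite negb_and orbC; apply/orP; left; apply/negP => /asboolP.
have Φτ e : drep D e = e -> Φ (dtau D e) = κ e.
  move=> eq; have := Φe e eq; rewrite !fS ?mulg1 ?mul1g //; last exact: dS_vrep.
  by rewrite -eq; apply: drep_org.
pose Ψ := pres_hom (R := R0) (fun x : outer_edge => dtau D (val x)).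
have R0E u v : R0 u v -> word_val (fun x : outer_edge => dtau D (val x)) u =
  word_val (fun x : outer_edge => dtau D (val x)) v by [].
have ΨM : forall a b, Ψ (a * b) = Ψ a * Ψ b := pres_homM R0E.
pose F : {multiplicative free_group outer_edge -> G} :=
  HB.pack Ψ (isMultiplicative.Build (free_group outer_edge) G Ψ ΨM).
exists F.
  apply: (can_inj (g := Φ)); apply: (@pres_ext _ _ _ (fun a => Φ (Ψ a)) id) => // [a b|x].
    by rewrite ΨM ΦM.
  rewrite /Ψ (pres_hom_gen R0E); case/andP: (valP x) => /eqP eq _.
  by rewrite Φτ // /κ valK.
move=> g; pose H := [set g | exists a, F a = g].
suff HT : H = [set: G] by have : [set: G] g by []; rewrite -HT.
apply: (@domain_generates _ _ _ D); first apply: is_subgroupP => [|_ _ [a <-] [b <-]|_ [a <-]].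
- by exists 1; apply: (hom1 ΨM).
- by exists (a * b); apply: ΨM.
- by exists a^-1; apply: (homV ΨM).
- by move=> v a _ /Afree->; exists 1; apply: (hom1 ΨM).
- move=> e eq; have [Se|nSe] := pselect (dS D (trm e)).
    by exists 1; rewrite dtau1 //; apply: (hom1 ΨM).
  have pe : (drep D e == e) && `[< ~ dS D (trm e) >] by rewrite eq eqxx; apply/asboolP.
  exists (pgen R0 (exist (fun e => (drep D e == e) && `[< ~ dS D (trm e) >]) e pe)).
  by rewrite /F /= /Ψ (pres_hom_gen R0E).
Qed.

End QuotientGraph.

Lemma finite_set_sub (T : choiceType) (A : set T) (P : pred T) (sT : subType P) :
  finite_set A -> (forall x : sT, A (val x)) -> finite_set [set: sT].
Proof.
move=> fA sA; apply: (@sub_finite_set _ _ (val @^-1` A)); first by move=> x _; apply: sA.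
by apply: finite_preimage => // x y _ _; apply: val_inj.
Qed.

(** * Free permutation representations *)

Section FreePerm.
Variable G : groupType.
Implicit Types (A : set G) (a b : G).

Definition free_rep A (Ω : finType) (ρ : G -> {perm Ω}) :=
  (forall a b, A a -> A b -> ρ (a * b) = ρ a * ρ b) /\
  (forall a x, A a -> ρ a x = x -> a = 1).

(** A product of regular representations, each group acting through its own
    factor. *)
Lemma ex_free_reps (I : eqType) (s : seq I) (A : I -> set G) :
  (forall i, i \in s -> is_subgroup (A i) /\ finite_set (A i)) ->
  exists Ω : finType, inhabited Ω /\
    forall i, i \in s -> exists ρ : G -> {perm Ω}, free_rep (A i) ρ.
Proof.
elim: s => [|i s IHs] fA; first by exists unit; split.
have [j js|Ω [[x0] Ωs]] := IHs; first by apply: fA; rewrite inE js orbT.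
have [sA fAi] := fA i (mem_head _ _).
pose B := fset_set (A i); pose Ω' : finType := (Ω * B)%type.
have BE (y : B) : A i (val y).
  by have := valP y; rewrite in_fset_set // inE.
have B1 : 1 \in B by rewrite in_fset_set // inE; apply: subgroup1.
exists Ω'; split; first by split; exact: (x0, [` B1]%fset).
move=> j; rewrite inE; have [->|_] := eqVneq j i; last first.
  move=> /Ωs[ρ [ρM ρfree]].
  have /choice[σ σP] a : exists p : {perm Ω'}, forall z, p z = (ρ a z.1, z.2).
    have inj : injective (fun z : Ω' => (ρ a z.1, z.2) : Ω').
      by move=> [x y] [x' y'] [/perm_inj-> ->].
    by exists (perm inj) => z; rewrite permE.
  exists σ; split=> [a b Aa Ab|a [x y] Aa].
    by apply/perm.permP => z; rewrite permM !σP ρM //= permM.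
  by rewrite σP => -[/ρfree]; apply.
(* The inverse is due to permutations composing from left to right. *)
move=> _; pose mulB a (y : B) : B := insubd y (a^-1 * val y).
have mulBE a y : A i a -> val (mulB a y) = a^-1 * val y.
  move=> Aa; rewrite insubdK // in_fset_set // inE.
  by apply: subgroupM => //; apply: subgroupV.
have /choice[σ σP] a : exists p : {perm Ω'}, A i a -> forall z, p z = (z.1, mulB a z.2).
  have [Aa|] := pselect (A i a); last by exists 1.
  have inj : injective (fun z : Ω' => (z.1, mulB a z.2) : Ω').
    move=> [x y] [x' y'] [-> e]; have := congr1 val e; rewrite !mulBE // => /mulgI h.
    by congr (_, _); apply: val_inj.
  by exists (perm inj) => _ z; rewrite permE.
exists σ; split=> [a b Aa Ab|a [x y] Aa].
  apply/perm.permP => z; rewrite permM !σP //; last exact: subgroupM.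
  by congr (_, _); apply: val_inj; rewrite !mulBE //= ?invgM ?mulgA //; apply: subgroupM.
rewrite σP // => -[e]; have := congr1 val e; rewrite mulBE //= => h.
by apply: invg_inj; apply: (@mulIg _ (val y)); rewrite invg1 mul1g.
Qed.

(** A maximal partial equivariant injection is defined everywhere: otherwise,
    for lack of surjectivity, one more orbit could be matched. *)
Lemma free_reps_conjugate A (Ω : finType) (ρ ρ' : G -> {perm Ω}) :
  is_subgroup A -> free_rep A ρ -> free_rep A ρ' ->
  exists k : {perm Ω}, forall a, A a -> ρ a * k = k * ρ' a.
Proof.
move=> sA [ρM ρfree] [ρM' ρfree'].
have A1 := subgroup1 sA; have AV := subgroupV sA; have AF := subgroupF sA.
pose good (R : {set Ω * Ω}) := [/\
  forall a x y, A a -> (x, y) \in R -> (ρ a x, ρ' a y) \in R,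
  forall x y y', (x, y) \in R -> (x, y') \in R -> y = y' &
  forall x x' y, (x, y) \in R -> (x', y) \in R -> x = x'].
have good0 : good finset.set0.
  by split=> [a x y _|x y y'|x x' y]; rewrite finset.inE.
have [R [Rinv Rfun Rinj] Rmax] := @ex_minimum _ good
  (fun R : {set Ω * Ω} => #|{: Ω * Ω}| - #|R|)%N (ex_intro _ _ good0).
have gen (σ : G -> {perm Ω}) : free_rep A σ ->
    [/\ forall x, σ 1 x = x, forall a x, A a -> σ a^-1 (σ a x) = x &
    forall a b x, A a -> A b -> σ a x = σ b x -> a = b].
  move=> [σM σfree].
  have σ1 : σ 1 = 1.
    by apply: (@mulgI _ (σ 1)); rewrite -σM // !mulg1.
  have σV a x : A a -> σ a^-1 (σ a x) = x.
    by move=> Aa; rewrite -permM -σM ?mulgV ?σ1 ?perm1 //; apply: AV.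
  split=> // [x|a b x Aa Ab ab]; first by rewrite σ1 perm1.
  apply/divg1_eq/(σfree _ x); first exact: AF.
  by rewrite σM ?permM ?ab ?σV //; apply: AV.
have [ρ1 ρV ρeq] := gen ρ (conj ρM ρfree).
have [ρ1' ρV' ρeq'] := gen ρ' (conj ρM' ρfree').
have total x : exists y, (x, y) \in R.
  apply: contrapT => nx.
  (* [R] is injective, so its domain and its range miss equally many points. *)
  have [y ny] : exists y, forall z, (z, y) \notin R.
    apply: contrapT => /forallNP all.
    have c1 : #|[set p.1 | p in R]%SET| = #|R|.
      by rewrite card_in_imset // => -[u v] [u' v'] uv uv' /= e; rewrite -e in uv' *;
         rewrite (Rfun _ _ _ uv uv').
    have c2 : #|[set p.2 | p in R]%SET| = #|R|.
      by rewrite card_in_imset // => -[u v] [u' v'] uv uv' /= e; rewrite -e in uv' *;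
         rewrite (Rinj _ _ _ uv uv').
    have : [set p.2 | p in R]%SET = finset.setTfor Ω.
      apply/finset.setP => v; rewrite [RHS]finset.inE; apply/imsetP.
      have /existsNP[z /negP/negPn zv] := all v.
      by exists (z, v).
    move=> /(congr1 (fun B : {set Ω} => #|B|)); rewrite c2 -c1 cardsT => c3.
    have /finset.setP/(_ x) : [set p.1 | p in R]%SET = finset.setTfor Ω.
      by apply/eqP; rewrite eqEcard finset.subsetT c3 cardsT leqnn.
    rewrite [RHS]finset.inE => /imsetP[[u v] uv /= xu]; apply: nx; exists v.
    by rewrite xu.
  pose R' : {set Ω * Ω} := [set p | (p \in R) ||
    `[< exists2 a, A a & p = (ρ a x, ρ' a y) >]]%SET.
  have R'P p : p \in R' <-> p \in R \/ exists2 a, A a & p = (ρ a x, ρ' a y).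
    rewrite finset.inE; split=> [/orP[|/asboolP]|[->//|h]]; [by left|by right|].
    by apply/orP; right; apply/asboolP.
  have oldx a z : A a -> (ρ a x, z) \notin R.
    move=> Aa; apply/negP => /(Rinv a^-1 _ _ (AV _ Aa)).
    by rewrite ρV // => h; apply: nx; exists (ρ' a^-1 z).
  have oldy a z : A a -> (z, ρ' a y) \notin R.
    move=> Aa; apply/negP => /(Rinv a^-1 _ _ (AV _ Aa)).
    by rewrite ρV' // (negbTE (ny _)).
  have goodR' : good R'.
    split.
    - move=> a u v Aa /R'P[/(Rinv a _ _ Aa) h|[b Ab [-> ->]]]; apply/R'P; first by left.
      right; exists (b * a); first exact: subgroupM.
      by rewrite ρM ?ρM' // !permM.
    - move=> u v v' /R'P[h|[a Aa [eu ->]]] /R'P[h'|[b Ab [eu' ->]]].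
      + exact: Rfun h h'.
      + by rewrite eu' (negbTE (oldx _ _ Ab)) in h.
      + by rewrite eu (negbTE (oldx _ _ Aa)) in h'.
      + by congr (ρ' _ y); apply: (ρeq _ _ x) => //; rewrite -eu -eu'.
    - move=> u u' v /R'P[h|[a Aa [-> ev]]] /R'P[h'|[b Ab [-> ev']]].
      + exact: Rinj h h'.
      + by rewrite ev' (negbTE (oldy _ _ Ab)) in h.
      + by rewrite ev (negbTE (oldy _ _ Aa)) in h'.
      + by congr (ρ _ x); apply: (ρeq' _ _ y) => //; rewrite -ev -ev'.
  have lt : #|R| < #|R'|.
    apply: proper_card; apply/properP; split.
      by apply/fintype.subsetP => p pR; apply/R'P; left.
    exists (x, y); last exact: ny.
    by apply/R'P; right; exists 1; rewrite ?ρ1 ?ρ1'.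
  have := Rmax R' goodR'; apply/negP; rewrite -ltnNge.
  by apply: ltn_sub2l => //; apply: leq_trans lt (max_card _).
have [k kR] := choice total.
have kinj : injective k.
  by move=> x x' e; apply: (Rinj _ _ (k x)); rewrite // e.
exists (perm kinj) => a Aa; apply/perm.permP => x; rewrite !permM !permE.
by apply: (Rfun (ρ a x)) => //; apply: Rinv.
Qed.

End FreePerm.

(** * Virtual freeness *)

Section VirtuallyFree.
Variables (G : groupType) (T : rtree) (A : tree_action G T) (D : fdomain A).

Local Notation "g ∙ v" := (vact A g v) (at level 35, right associativity).
Local Notation "g ∘ e" := (eact A g e) (at level 35, right associativity).

Hypothesis finite_dS : finite_set (dS D).
Hypothesis finite_drep : finite_set [set e | drep D e = e].
Hypothesis finite_vstab : forall v, finite_set (vstab A v).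

Lemma quotient_mgraph_finite : finite_mgraph (quotient_mgraph D).
Proof.
split; first by apply: finite_set_sub finite_dS _ => P; apply: qvertex_in.
have fr : finite_set [set: qrep D].
  by apply: finite_set_sub finite_drep _ => e; apply: qrepK.
apply: (@sub_finite_set _ _ ([set: qrep D] `*` [set: bool])) => //.
by apply: finite_setX => //; apply: finite_finset.
Qed.

Lemma quotient_groups_finite (P : quotient_gog D) : finite_set [set: vgroup P].
Proof. by apply: finite_set_sub (finite_vstab (val P)) _ => a; apply: sub_in. Qed.

Lemma tree_finitely_generated : finitely_generated G.
Proof.
exists (\bigcup_(v in dS D) vstab A v `|` dtau D @` [set e | drep D e = e]).
  rewrite finite_setU; split; last exact: finite_image.
  exact: bigcup_finite.
move=> H sH HS; apply: (@domain_generates _ _ _ D) => // [v a Sv av|e eq].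
  by apply: HS; left; exists v.
by apply: HS; right; exists e.
Qed.

Definition sub_action (N : set G) (sN : is_subgroup N) : tree_action (subgroup_type sN) T :=
  @TreeAction (subgroup_type sN) T (fun n => vact A (val n)) (fun n => eact A (val n))
    (vact1 A) (fun n m => vactM A (val n) (val m))
    (eact1 A) (fun n m => eactM A (val n) (val m))
    (fun n => org_act A (val n)) (fun n => trm_act A (val n)).

(** [N] acts freely on the tree of [G]. *)
Lemma free_subgroup (N : set G) : is_subgroup N ->
  (forall v g, N g -> g ∙ v = v -> g = 1) -> is_free_subgroup N.
Proof.
move=> sN Nfree; have [DN] := ex_fdomain (sub_action sN).
have [|F Finj Fsurj] := free_action_free DN.
  by move=> v n nv; apply: val_inj; apply: Nfree nv; apply: sub_in.
pose f (x : free_group (outer_edge DN)) : G := val (F x).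
have fM a b : f (a * b) = f a * f b by rewrite /f gmulfM.
exists (outer_edge DN).
exists (HB.pack_for {multiplicative free_group (outer_edge DN) -> G} f
  (isMultiplicative.Build (free_group (outer_edge DN)) G f fM)).
split=> [a b /= /val_inj/Finj //|]; apply/seteqP; split=> [_ [a _ <-]|n Nn].
  exact: sub_in.
have [a aE] := Fsurj (to_sub sN n); exists a => //=.
by rewrite /f aE to_subK.
Qed.

(** The free representations of the stabilizers of the domain, made compatible
    along its edges by conjugation, extend to the whole group. *)
Lemma tree_finite_quotient : exists (Ω : finType) (Φ : G -> {perm Ω}),
  (forall g h, Φ (g * h) = Φ g * Φ h) /\
  (forall v a, a ∙ v = v -> Φ a = 1 -> a = 1).
Proof.
have [Ω [[x0] reps]] := @ex_free_reps G _ (fset_set (dS D)) (vstab A)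
  (fun v _ => conj (vstab_subgroup A v) (finite_vstab v)).
have /choice[φ φP] v : exists ρ : G -> {perm Ω}, dS D v -> free_rep (vstab A v) ρ.
  have [Sv|] := pselect (dS D v); last by exists (fun _ => 1).
  by have [|ρ ρP] := reps v; [rewrite in_fset_set // inE|exists ρ].
have /choice[κ κP] e : exists k : {perm Ω}, drep D e = e -> forall a, a ∘ e = e ->
    φ (org e) a * k = k * φ (dvrep D (trm e)) ((dtau D e)^-1 * a * dtau D e).
  have [eq|] := pselect (drep D e = e); last by exists 1.
  have So : dS D (org e) by rewrite -eq; apply: drep_org.
  have [M1 F1] := φP _ So; have [M2 F2] := φP _ (dS_vrep D (trm e)).
  pose B := [set a | a ∘ e = e].
  have sB : is_subgroup B.
    apply: is_subgroupP => [|a b ae be|a ae]; rewrite /B /=.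
    - exact: eact1.
    - by rewrite eactM be.
    - by rewrite -{1}ae eactK.
  have Bo a : B a -> vstab A (org e) a by move=> ae; rewrite /vstab /= -org_act ae.
  have Bt a : B a -> vstab A (dvrep D (trm e)) ((dtau D e)^-1 * a * dtau D e).
    by move=> ae; rewrite /vstab /= !vactM dvrepK -trm_act ae.
  have [||k kP] := @free_reps_conjugate G B Ω (φ (org e))
    (fun a => φ (dvrep D (trm e)) ((dtau D e)^-1 * a * dtau D e)) sB; last by exists k.
  - by split=> [a b /Bo ao /Bo bo|a x /Bo ao]; [apply: M1|apply: F1].
  - split=> [a b /Bt at' /Bt bt|a x /Bt at' /(F2 _ _ at') h].
      by rewrite -M2 // !mulgA mulgK.
    apply: (@mulgI _ (dtau D e)^-1); apply: (@mulIg _ (dtau D e)).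
    by rewrite h mulg1 mulVg.
have [||Φ [f [ΦM Φv _ _]]] := @hom_extension G T A D {perm Ω} φ κ.
- by move=> v a b Sv av bv; apply: (φP v Sv).1.
- by move=> e a eq; apply: κP.
exists Ω, Φ; split=> // v a av Φa.
pose b := (dgam D v)^-1 * a * dgam D v.
have bv : b ∙ dvrep D v = dvrep D v by rewrite !vactM dvrepK av.
have Φb : Φ b = 1 by rewrite !ΦM Φa mulg1 -ΦM mulVg (hom1 ΦM).
have := Φv _ _ (dS_vrep D v) bv; rewrite Φb mul1g -{1}[f _]mulg1 => /mulgI φb.
have b1 : b = 1.
  by apply: (φP _ (dS_vrep D v)).2 bv _; rewrite -φb perm1.
apply: (@mulgI _ (dgam D v)^-1); apply: (@mulIg _ (dgam D v)).
by rewrite -/b b1 mulg1 mulVg.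
Unshelve. exact: x0.
Qed.

Theorem tree_virtually_free : virtually_free G.
Proof.
split; first exact: tree_finitely_generated.
have [Ω [Φ [ΦM Φfree]]] := tree_finite_quotient.
pose N := [set g | Φ g = 1].
have sN : is_subgroup N.
  apply: is_subgroupP => [|a b|a]; rewrite /N /=.
  - exact: hom1 ΦM.
  - by rewrite ΦM => -> ->; rewrite mulg1.
  - by rewrite (homV ΦM) => ->; rewrite invg1.
exists N; split=> //.
  by apply: free_subgroup => // v g Ng gv; apply: Φfree gv Ng.
rewrite /finite_index; apply: (@sub_finite_set _ _
  ((fun k => [set x | Φ x = k]) @` [set: {perm Ω}])).
  move=> _ [g _ <-]; exists (Φ g) => //; apply/seteqP; split=> [x /= xg|_ [h Nh <-]].
    exists (g^-1 * x); last by rewrite mulVKg.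
    by rewrite /N /= ΦM (homV ΦM) xg mulVg.
  by rewrite /= ΦM Nh mulg1.
by apply: finite_image; apply: finite_finset.
Qed.

End VirtuallyFree.

(** * The tree of a nested family of cuts *)

Section TreeSet.
Variables (X : choiceType) (E : set (set X)) (x0 : X).
Implicit Types (C D F : set X) (O : set (set X)).
Hypothesis EC : forall C, E C -> E (~` C).
Hypothesis E_neq0 : forall C, E C -> C !=set0.
Hypothesis E_nested : forall C D, E C -> E D ->
  [\/ C `<=` D, C `<=` ~` D, ~` C `<=` D | D `<=` C].
Hypothesis E_finite : forall x y, finite_set [set C | [/\ E C, C x & ~ C y]].

Let subC C D : C `<=` D -> ~` D `<=` ~` C.
Proof. by move=> CD x nDx /CD. Qed.

Let not_subC C : E C -> ~ C `<=` ~` C.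
Proof. by move=> /E_neq0[x Cx] /(_ x Cx). Qed.

Definition pointing x : set (set X) := [set C | E C /\ C x].

(** The finiteness condition keeps the choices that correspond to vertices of
    the tree and excludes those that correspond to its ends. *)
Definition orientation O := [/\ O `<=` E, forall C, E C -> O C \/ O (~` C),
  forall C, O C -> ~ O (~` C), forall C D, O C -> E D -> C `<=` D -> O D &
  finite_set (O `\` pointing x0)].

Lemma pointing_orientation x : orientation (pointing x).
Proof.
split=> [C []//|C EC'|C [_ Cx] [_]//|C D [_ Cx] ED CD|].
- by have [Cx|nCx] := pselect (C x); [left|right; split=> //; apply: EC].
- by split=> //; apply: CD.
- by apply: sub_finite_set (E_finite x x0) => C [[EC' Cx] /not_andP[//|nCx]].
Qed.

Section Orientation.
Variable O : set (set X).
Hypothesis oO : orientation O.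

Lemma orientation_finite x : finite_set (O `\` pointing x).
Proof.
have [OE _ _ _ fO] := oO.
apply: (@sub_finite_set _ _ ((O `\` pointing x0) `|` [set C | [/\ E C, C x0 & ~ C x]])).
  move=> C [OC npx]; have [Cx0|nCx0] := pselect (C x0); last by left; split=> // -[].
  by right; split; [apply: OE| |move=> Cx; apply: npx; split=> //; apply: OE].
by rewrite finite_setU.
Qed.

Lemma orientation_eq O' : orientation O' -> O `<=` O' -> O = O'.
Proof.
move=> [O'E _ O'x _ _] OO'; have [_ Oe _ _ _] := oO.
apply/seteqP; split=> // C O'C; have [//|/OO'] := Oe C (O'E C O'C).
by move/(O'x C O'C).
Qed.

Definition minimal_in C := O C /\ forall D, O D -> D `<=` C -> D = C.

(** Only finitely many elements of [O] fail to contain [x]. *)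
Lemma ex_minimal_in x : O <> pointing x -> exists2 C, minimal_in C & ~ C x.
Proof.
move=> neO; pose F := O `\` pointing x; have fF : finite_set F := orientation_finite x.
have [OE _ _ _ _] := oO.
have [C0 FC0] : exists C, F C.
  apply: contrapT => /forallNP noF; apply: neO.
  apply: (orientation_eq (pointing_orientation x)) => C OC.
  by apply: contrapT => npC; apply: (noF C).
have [C [OC npC] Cmin] := @ex_minimum _ F
  (fun C => csize (F `&` [set D | D `<=` C])) (ex_intro _ C0 FC0).
have nCx : ~ C x by move=> Cx; apply: npC; split=> //; apply: OE.
exists C => //; split=> // D OD DC; apply: contrapT => neDC.
have FD : F D by split=> // -[_ /DC].
have := Cmin D FD; apply/negP; rewrite -ltnNge.
apply: (@csize_lt _ _ _ C); first exact: sub_finite_set (@subIsetl _ _ _) fF.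
- by move=> D' [FD' D'D]; split=> // y /D'D/DC.
- by split.
- by move=> [_ CD]; apply: neDC; apply/seteqP.
Qed.

End Orientation.

(** The vertex in front of the directed edge [C], and the midpoint of the
    undirected edge formed by [C] and its complement. *)
Definition start C : set (set X) :=
  [set D | [/\ E D, D <> ~` C & C `<=` D \/ ~` C `<=` D]].

Definition mid C : set (set X) :=
  [set D | [/\ E D, D <> C, D <> ~` C & C `<=` D \/ ~` C `<=` D]].

Lemma midC C : mid (~` C) = mid C.
Proof.
by apply/seteqP; split=> D [ED D1 D2 D3]; split=> //; rewrite ?setCK in D1 D2 D3 *;
   tauto.
Qed.

Lemma mid_start C : mid C `<=` start C. Proof. by move=> D []. Qed.

Lemma start_mid C D : start C D -> D <> C -> mid C D. Proof. by move=> []. Qed.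

Lemma start_self C : E C -> start C C.
Proof. by move=> eC; split=> //; [move=> e; apply: (not_subC eC); rewrite -e|left]. Qed.

(** Nestedness lets every other cut point to one side of [C]. *)
Lemma start_orientation C : E C -> orientation (start C).
Proof.
move=> eC; split.
- by move=> D [].
- move=> D eD; have [CD|CD|CD|DC] := E_nested eC eD.
  + by left; split=> //; [move=> e; apply: (not_subC eC); rewrite e in CD|left].
  + right; split; [exact: EC| |by left].
    by move=> e; apply: (not_subC eC); rewrite e in CD.
  + have [e|ne] := pselect (D = ~` C); last by left; split=> //; right.
    by right; rewrite e setCK; apply: start_self.
  + have [e|ne] := pselect (D = C); first by left; rewrite e; apply: start_self.
    right; split; [exact: EC| |by right; apply: subC].
    by move=> /setC_inj.
- move=> D [eD D1 D2] [eD' D1' D2']; have [x Cx] := E_neq0 eC.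
  have [y nCy] := E_neq0 (EC eC).
  case: D2 D2' => [CD|CD] [CD'|CD'].
  + by have := CD' x Cx; apply; apply: CD.
  + apply: D1'; congr (~` _); apply/seteqP; split=> // z Dz.
    by apply: contrapT => /CD'; apply.
  + apply: D1; apply/seteqP; split=> // z Dz Cz.
    by have := CD' z Cz; apply.
  + by have := CD' y nCy; apply; apply: CD.
- move=> D F [eD D1 D2] eF DF; split=> // [e|].
    case: D2 => CD; first by apply: (not_subC eC); rewrite -e; apply: subset_trans DF.
    by apply: D1; apply/seteqP; split=> //; rewrite -e.
  by case: D2 => CD; [left|right]; apply: subset_trans DF.
- have [x Cx] := E_neq0 eC; have [y nCy] := E_neq0 (EC eC).
  apply: (@sub_finite_set _ _ ([set D | [/\ E D, D x & ~ D x0]] `|`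
                                [set D | [/\ E D, D y & ~ D x0]])).
    move=> D [[eD _ CD] npD]; have nD0 : ~ D x0 by move=> Dx0; apply: npD.
    by case: CD => CD; [left|right]; split=> //; apply: CD.
  by rewrite finite_setU.
Qed.

(** By nestedness, a minimal element determines the choice made for every other
    cut. *)
Lemma minimal_in_start O C : orientation O -> minimal_in O C -> O = start C.
Proof.
move=> oO [OC Cmin]; have [OE _ Ox Ou _] := oO; have eC := OE C OC.
apply: (orientation_eq oO (start_orientation eC)) => D OD.
have eD := OE D OD; have neD : D <> ~` C by move=> e; apply: (Ox C OC); rewrite -e.
split=> //; have [CD|CD|CD|DC] := E_nested eC eD; [by left| |by right|].
- by case: (Ox D OD); apply: Ou OC _ CD; apply: EC.
- by left; rewrite (Cmin D).
Qed.

Lemma mid_not_orientation C O : E C -> orientation O -> O <> mid C.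
Proof.
move=> eC [_ Oe _ _ _] e; rewrite e in Oe.
by have [[_]|[]] := Oe C eC.
Qed.

Definition cut_vertex : set (set (set X)) :=
  [set v | orientation v \/ exists2 C, E C & v = mid C].

(** The size of the symmetric difference with the family pointing to [x0]; each
    edge of the tree changes it by one. *)
Definition cut_height (v : set (set X)) :=
  (csize (v `\` pointing x0) + csize (pointing x0 `\` v))%N.

Lemma orientation_finiteC O : orientation O -> finite_set (pointing x0 `\` O).
Proof.
move=> [_ Oe _ _ fO]; apply: (@sub_finite_set _ _ (setC @` (O `\` pointing x0))).
  move=> C [[eC Cx0] nOC]; exists (~` C); last by rewrite setCK.
  by split; [case: (Oe C eC)|case].
exact: finite_image.
Qed.

Lemma mid_finiteC C : E C -> finite_set (pointing x0 `\` mid C).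
Proof.
move=> eC; apply: (@sub_finite_set _ _ ((pointing x0 `\` start C) `|` [set C])).
  move=> D [pD nmD]; have [->|neD] := pselect (D = C); first by right.
  by left; split=> // sD; apply: nmD; apply: start_mid.
rewrite finite_setU; split; last exact: finite_set1.
exact: orientation_finiteC (start_orientation eC).
Qed.

Lemma cut_height_away C : E C -> ~ C x0 -> cut_height (mid C) < cut_height (start C).
Proof.
move=> eC nC0; rewrite /cut_height -addSn; apply: leq_add.
  apply: (@csize_lt _ _ _ C); first by case: (start_orientation eC).
  - by move=> D [/mid_start].
  - by split; [apply: start_self|case].
  - by case=> -[].
apply: csize_le; first exact: orientation_finiteC (start_orientation eC).
move=> D [pD nmD]; split=> // sD; apply: nmD; apply: start_mid => // e.
by case: pD; rewrite e.
Qed.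

Lemma cut_height_towards C : E C -> C x0 -> cut_height (start C) < cut_height (mid C).
Proof.
move=> eC C0; rewrite /cut_height -addnS; apply: leq_add.
  apply: csize_le.
    apply: (@sub_finite_set _ _ (start C `\` pointing x0)); last first.
      by case: (start_orientation eC).
    by move=> D [/mid_start].
  by move=> D [sD npD]; split=> //; apply: start_mid => // e; apply: npD; rewrite e.
apply: (@csize_lt _ _ _ C); first exact: mid_finiteC.
- by move=> D [pD nsD]; split=> // /mid_start.
- by split=> // -[].
- by case=> _; apply; apply: start_self.
Qed.

Definition ctvertex := {v | v \in cut_vertex}.
Definition ctedge := {C | C \in E}.

Lemma ctedge_in (e : ctedge) : E (val e).
Proof. by rewrite -in_setE; apply: valP. Qed.

Lemma ctvertex_in (v : ctvertex) : cut_vertex (val v).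
Proof. by have := valP v; rewrite in_setE. Qed.

Definition ct_org (e : ctedge) : ctvertex :=
  exist _ (start (val e)) (mem_set (or_introl (start_orientation (ctedge_in e)))).

Definition ct_trm (e : ctedge) : ctvertex :=
  exist _ (mid (val e)) (mem_set (or_intror (ex_intro2 _ _ _ (ctedge_in e) erefl))).

Definition ct_root : ctvertex :=
  exist _ (pointing x0) (mem_set (or_introl (pointing_orientation x0))).

Definition ct_height (v : ctvertex) := cut_height (val v).

Let joins e v u := (ct_org e = v /\ ct_trm e = u) \/ (ct_org e = u /\ ct_trm e = v).

Fact ct_height_root : ct_height ct_root = 0.
Proof. by rewrite /ct_height /cut_height /= setDv /csize fset_set0. Qed.

Fact ct_height_edge e : ct_height (ct_org e) <> ct_height (ct_trm e).
Proof.
rewrite /ct_height /= => h; have eC := ctedge_in e.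
have [C0|nC0] := pselect (val e x0).
  by have := cut_height_towards eC C0; rewrite h ltnn.
by have := cut_height_away eC nC0; rewrite h ltnn.
Qed.

Fact ct_parent_exists v : v <> ct_root ->
  exists e u, joins e v u /\ ct_height u < ct_height v.
Proof.
move=> nev; have [ov|[C eC vC]] := ctvertex_in v.
  have [|C Cmin nC0] := @ex_minimal_in _ ov x0.
    by move=> e; apply: nev; apply: val_inj.
  have eC : E C by case: ov => OE _ _ _ _; apply: OE; case: Cmin.
  have vC := minimal_in_start ov Cmin.
  pose e : ctedge := exist _ C (mem_set eC); exists e, (ct_trm e); split.
    by left; split=> //; apply: val_inj.
  by rewrite /ct_height vC; apply: cut_height_away.
have [D eD [vD D0]] : exists2 D, E D & val v = mid D /\ D x0.
  have [C0|nC0] := pselect (C x0); first by exists C.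
  by exists (~` C); [apply: EC|rewrite midC].
pose e : ctedge := exist _ D (mem_set eD); exists e, (ct_org e); split.
  by right; split=> //; apply: val_inj.
by rewrite /ct_height vD; apply: cut_height_towards.
Qed.

Lemma ct_org_lower e : ct_height (ct_trm e) < ct_height (ct_org e) -> ~ val e x0.
Proof.
move=> + C0; apply/negP; rewrite -leqNgt ltnW //.
exact: cut_height_towards (ctedge_in e) C0.
Qed.

Lemma ct_trm_lower e : ct_height (ct_org e) < ct_height (ct_trm e) -> val e x0.
Proof.
move=> lt; apply: contrapT => nC0; move: lt; apply/negP; rewrite -leqNgt ltnW //.
exact: cut_height_away (ctedge_in e) nC0.
Qed.

(** The elements of an orientation that do not contain [x0] form a chain, whose
    least element gives the edge towards the root. *)
Fact ct_parent_unique v e u e' u' : joins e v u -> joins e' v u' ->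
  ct_height u < ct_height v -> ct_height u' < ct_height v -> e = e'.
Proof.
have eC := ctedge_in e; have eC' := ctedge_in e'.
move=> [[<- <-]|[<- <-]] [[h1 <-]|[<- h1]]; have {h1} := congr1 val h1 => /= h1.
- move=> /ct_org_lower n0; rewrite -(val_inj (h1 : val (ct_org e') = val (ct_org e))).
  move=> /ct_org_lower n0'.
  have sub C D : E C -> start D = start C -> ~ C x0 -> ~ D x0 -> D `<=` C.
    move=> eC1 sDC nC0 nD0; have := start_self eC1; rewrite -sDC => -[_ _ [//|DC]].
    by case: nC0; apply: DC.
  by apply: val_inj; apply/seteqP; split; apply: sub.
- by case: (mid_not_orientation eC' (start_orientation eC)).
- by case: (mid_not_orientation eC (start_orientation eC')).
- move=> /ct_trm_lower C0; rewrite -(val_inj (h1 : val (ct_trm e') = val (ct_trm e))).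
  move=> /ct_trm_lower C0'.
  have [_ Oe _ _ _] := start_orientation eC'.
  apply: val_inj; apply: contrapT => ne.
  have [sC|sC] := Oe _ eC.
    by have := start_mid sC ne; rewrite h1 => -[].
  have := start_mid sC; rewrite h1 => h.
  by have [|_ _] := h; [move=> e1; have := C0'; rewrite -e1|].
Qed.

Definition cut_tree : rtree :=
  RTree ct_height_root ct_height_edge ct_parent_exists ct_parent_unique.

(** * The action on the tree of cuts *)

Variables (G : groupType) (act : G -> X -> X).
Hypothesis act1 : forall x, act 1 x = x.
Hypothesis actM : forall g h x, act (g * h) x = act g (act h x).

Definition set_act (g : G) C : set X := [set x | C (act g^-1 x)].

Hypothesis E_act : forall g C, E C -> E (set_act g C).

Lemma set_act1 C : set_act 1 C = C.
Proof. by apply/seteqP; split=> x; rewrite /set_act /= invg1 act1. Qed.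

Lemma set_actM g h C : set_act (g * h) C = set_act g (set_act h C).
Proof. by apply/seteqP; split=> x; rewrite /set_act /= invgM actM. Qed.

Lemma set_actK g C : set_act g^-1 (set_act g C) = C.
Proof. by rewrite -set_actM mulVg set_act1. Qed.

Lemma set_actVK g C : set_act g (set_act g^-1 C) = C.
Proof. by rewrite -set_actM mulgV set_act1. Qed.

Lemma set_act_inj g : injective (set_act g).
Proof. exact: can_inj (set_actK g). Qed.

Lemma set_act_sub g C D : C `<=` D -> set_act g C `<=` set_act g D.
Proof. by move=> CD x; apply: CD. Qed.

Lemma set_act_subV g C D : set_act g C `<=` D -> C `<=` set_act g^-1 D.
Proof. by move=> /(@set_act_sub g^-1); rewrite set_actK. Qed.

Lemma set_act_subK g C D : C `<=` set_act g^-1 D -> set_act g C `<=` D.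
Proof. by move=> /(@set_act_sub g); rewrite set_actVK. Qed.

Definition family_act (g : G) O : set (set X) := [set D | O (set_act g^-1 D)].

Lemma E_actV g D : E (set_act g^-1 D) -> E D.
Proof. by move=> /(E_act g); rewrite set_actVK. Qed.

Lemma family_act1 O : family_act 1 O = O.
Proof. by apply/seteqP; split=> D; rewrite /family_act /= invg1 set_act1. Qed.

Lemma family_actM g h O : family_act (g * h) O = family_act g (family_act h O).
Proof. by apply/seteqP; split=> D; rewrite /family_act /= invgM set_actM. Qed.

Lemma family_act_pointing g x : family_act g (pointing x) = pointing (act g x).
Proof.
apply/seteqP; split=> D [eD Dx]; split.
- exact: E_actV eD.
- by move: Dx; rewrite /set_act /= invgK.
- exact: E_act.
- by rewrite /set_act /= invgK.
Qed.

Lemma set_act_eq g C D : set_act g^-1 D = C -> D = set_act g C.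
Proof. by move=> <-; rewrite set_actVK. Qed.

Lemma family_act_start g C : family_act g (start C) = start (set_act g C).
Proof.
apply/seteqP; split=> D [eD D1 D2]; split.
- exact: E_actV eD.
- by move=> e; apply: D1; rewrite e -[~` _]/(set_act g (~` C)) set_actK.
- by case: D2 => h; [left|right]; [|rewrite -[~` _]/(set_act g (~` C))]; apply: set_act_subK.
- exact: E_act.
- by move=> /set_act_eq.
- by case: D2 => h; [left|right]; apply: set_act_subV.
Qed.

Lemma family_act_mid g C : family_act g (mid C) = mid (set_act g C).
Proof.
apply/seteqP; split=> D [eD D1 D1' D2]; split.
- exact: E_actV eD.
- by move=> e; apply: D1; rewrite e set_actK.
- by move=> e; apply: D1'; rewrite e -[~` _]/(set_act g (~` C)) set_actK.
- by case: D2 => h; [left|right]; [|rewrite -[~` _]/(set_act g (~` C))]; apply: set_act_subK.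
- exact: E_act.
- by move=> /set_act_eq.
- by move=> /set_act_eq.
- by case: D2 => h; [left|right]; apply: set_act_subV.
Qed.

Lemma family_act_orientation g O : orientation O -> orientation (family_act g O).
Proof.
move=> oO; have [OE Oe Ox Ou _] := oO; split.
- by move=> D /OE/E_actV.
- by move=> C eC; apply: Oe; apply: E_act.
- by move=> C OC; apply: Ox OC.
- by move=> C D OC eD CD; apply: Ou OC _ _; [apply: E_act|apply: set_act_sub].
- apply: (@sub_finite_set _ _ (set_act g @` (O `\` pointing (act g^-1 x0)))).
    move=> D [OD npD]; exists (set_act g^-1 D); last exact: set_actVK.
    split=> // -[eD]; rewrite /set_act /= invgK -actM mulgV act1 => Dx0.
    by apply: npD; split=> //; apply: E_actV eD.
  by apply: finite_image; apply: orientation_finite.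
Qed.

Lemma family_act_vertex g v : cut_vertex v -> cut_vertex (family_act g v).
Proof.
case=> [ov|[C eC ->]]; first by left; apply: family_act_orientation.
by right; exists (set_act g C); [apply: E_act|apply: family_act_mid].
Qed.

Definition ct_vact (g : G) (v : ctvertex) : ctvertex :=
  exist _ (family_act g (val v)) (mem_set (family_act_vertex g (ctvertex_in v))).

Definition ct_eact (g : G) (e : ctedge) : ctedge :=
  exist _ (set_act g (val e)) (mem_set (E_act g (ctedge_in e))).

Fact ct_vact1 v : ct_vact 1 v = v.
Proof. by apply: val_inj; apply: family_act1. Qed.
Fact ct_vactM g h v : ct_vact (g * h) v = ct_vact g (ct_vact h v).
Proof. by apply: val_inj; apply: family_actM. Qed.
Fact ct_eact1 e : ct_eact 1 e = e.
Proof. by apply: val_inj; apply: set_act1. Qed.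
Fact ct_eactM g h e : ct_eact (g * h) e = ct_eact g (ct_eact h e).
Proof. by apply: val_inj; apply: set_actM. Qed.
Fact ct_org_act g e : ct_org (ct_eact g e) = ct_vact g (ct_org e).
Proof. by apply: val_inj; rewrite /= family_act_start. Qed.
Fact ct_trm_act g e : ct_trm (ct_eact g e) = ct_vact g (ct_trm e).
Proof. by apply: val_inj; rewrite /= family_act_mid. Qed.

Definition cut_tree_action : tree_action G cut_tree :=
  @TreeAction G cut_tree ct_vact ct_eact ct_vact1 ct_vactM ct_eact1 ct_eactM
    ct_org_act ct_trm_act.

End TreeSet.

(** * Invariance of the optimal cuts *)

Section Invariance.
Variables (G : groupType) (Γ : sgraph) (a : graph_action G Γ).
Hypothesis Γ_connected : connected_graph Γ.
Implicit Types C D F : set Γ.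

Local Notation "g • C" := (set_act a g C) (at level 35, right associativity).

Lemma actK g v : a g^-1 (a g v) = v.
Proof. by rewrite -actM mulVg act1. Qed.

Lemma actVK g v : a g (a g^-1 v) = v.
Proof. by rewrite -actM mulgV act1. Qed.

Let actsK g C : g^-1 • (g • C) = C := set_actK (act1 a) (actM a) g C.
Let actsVK g C : g • (g^-1 • C) = C := set_actVK (act1 a) (actM a) g C.

Lemma act_in g C v : (g • C) (a g v) <-> C v.
Proof. by rewrite /set_act /= actK. Qed.

Lemma boundary_act g C :
  boundary (g • C) = (fun e => (a g e.1, a g e.2)) @` boundary C.
Proof.
apply/seteqP; split=> [[u v] [/= uv Cu nCv]|_ [[u v] [/= uv Cu nCv] <-]].
  exists (a g^-1 u, a g^-1 v); last by rewrite /= !actVK.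
  by split; rewrite //= act_adj.
by split; rewrite /= ?act_adj // act_in.
Qed.

Lemma finite_boundary_act g C : finite_boundary C -> finite_boundary (g • C).
Proof. by move=> fC; rewrite /finite_boundary boundary_act; apply: finite_image. Qed.

Lemma cut_size_act g C : finite_boundary C -> cut_size (g • C) = cut_size C.
Proof.
move=> fC; rewrite /cut_size boundary_act csize_image_inj // => -[u v] [u' v'] [].
by move=> /(can_inj (actK g))-> /(can_inj (actK g))->.
Qed.

Lemma cohesive_act g C : cohesive C -> cohesive (g • C).
Proof.
move=> cC D DC [x Dx] Dadj.
have := cC (g^-1 • D); rewrite -{1}(actsK g C) => h.
suff : C `<=` g^-1 • D by move=> /(@set_act_sub _ _ a g); rewrite actsVK.
apply: h; first exact: set_act_sub.
- by exists (a g^-1 x); rewrite /set_act /= invgK actVK.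
- move=> u v uv; rewrite /set_act /= invgK => Du Cv.
  by apply: (Dadj (a g u)); rewrite ?act_adj // act_in.
Qed.

Lemma kcut_act k g C : kcut k C -> kcut k (g • C).
Proof.
move=> [fC Ck cC cC']; split; first exact: finite_boundary_act.
- by rewrite cut_size_act.
- exact: cohesive_act.
- by rewrite -[~` _]/(g • ~` C); apply: cohesive_act.
Qed.

Lemma cross_act g F C : cross F C -> cross (g • F) (g • C).
Proof.
move=> [[x1 [h1 l1]] [x2 [h2 l2]] [x3 [h3 l3]] [x4 [h4 l4]]].
by split; [exists (a g x1)|exists (a g x2)|exists (a g x3)|exists (a g x4)];
   split; rewrite /setC /mkset act_in.
Qed.

Lemma crossing_act k g C : crossing k (g • C) = set_act a g @` crossing k C.
Proof.
apply/seteqP; split=> [F [kF xF]|_ [F [kF xF] <-]].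
  exists (g^-1 • F); last exact: actsVK.
  by split; [apply: kcut_act|have := cross_act g^-1 xF; rewrite actsK].
by split; [apply: kcut_act|apply: cross_act].
Qed.

Lemma csize_crossing_act k g C : finite_boundary C ->
  csize (crossing k (g • C)) = csize (crossing k C).
Proof.
move=> fC; rewrite crossing_act csize_image_inj //; first exact: finite_crossing.
exact: (set_act_inj (act1 a) (actM a)).
Qed.

Definition push g (ξ : set_system Γ) : set_system Γ := [set A | ξ (g^-1 • A)].

(** [push g ξ] is the image of [ξ] under the bijection [a g]. *)
Lemma push_ultra g ξ : UltraFilter ξ -> UltraFilter (push g ξ).
Proof.
move=> Uξ; have -> : push g ξ = [set a g @` A | A in ξ].
  apply/seteqP; split=> [A ξA|_ [A ξA <-]].
    exists (g^-1 • A) => //; apply/seteqP; split=> [_ [x + <-]|x Ax].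
      by rewrite /set_act /= invgK.
    by exists (a g^-1 x); rewrite ?actVK // /set_act /= invgK actVK.
  rewrite /push /mkset; apply: filterS ξA => x Ax.
  by exists x => //; rewrite /= invgK.
apply: ultra_image; apply/seteqP; split=> // x _.
by exists (a g^-1 x) => //; apply: actVK.
Qed.

Lemma minimal_cut_push g ξ η D :
  minimal_cut (push g ξ) (push g η) D <-> minimal_cut ξ η (g^-1 • D).
Proof.
split=> -[fD sD mD].
  have fD' := finite_boundary_act g^-1 fD.
  split=> // F fF sF; rewrite cut_size_act // -(cut_size_act g fF).
  apply: mD; first exact: finite_boundary_act.
  by rewrite /separates /push /mkset actsK.
have fD' : finite_boundary D.
  by rewrite -(actsVK g D); apply: finite_boundary_act.
split=> // F fF sF; rewrite -(cut_size_act g^-1 fD') -(cut_size_act g^-1 fF).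
by apply: mD => //; apply: finite_boundary_act.
Qed.

Lemma optimal_cuts_act k g C : optimal_cuts k C -> optimal_cuts k (g • C).
Proof.
move=> [ξ [η [Uξ Uη [mC Ck oC]]]]; exists (push g ξ), (push g η).
have [fC _ _] := mC; split; [exact: push_ultra|exact: push_ultra|split].
- by apply/minimal_cut_push; rewrite actsK.
- by rewrite cut_size_act.
- move=> D mD; have [fD _ _] := mD; rewrite csize_crossing_act //.
  rewrite -(csize_crossing_act k g^-1 fD); apply: oC.
  exact/minimal_cut_push.
Qed.

End Invariance.

(** * Finiteness of the stabilizers *)

Section Stabilizers.
Variables (G : groupType) (Γ : sgraph) (a : graph_action G Γ).
Hypothesis Γ_connected : connected_graph Γ.
Hypothesis Γ_locally_finite : locally_finite Γ.
Variable W : set Γ.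
Hypothesis W_finite : finite_set W.
Hypothesis W_orbits : forall v, exists g w, W w /\ v = a g w.
Hypothesis stab_finite : forall v, finite_set (stabilizer a v).
Variables (T : sgraph) (X : T -> {fset Γ}) (w d : nat).
Hypothesis X_decomp : tree_decomposition X.
Hypothesis X_width : forall t, #|` X t| <= w.
Hypothesis Γ_degree : forall v : Γ,
  finite_set [set u | adj v u] /\ csize [set u | adj v u] <= d.
Variable x0 : Γ.

Local Notation "g • C" := (set_act a g C) (at level 35, right associativity).
Let k := (w * d)%N.
Let E : set (set Γ) := optimal_cuts k.

Let actsK g C : g^-1 • (g • C) = C := set_actK (act1 a) (actM a) g C.
Let actsVK g C : g • (g^-1 • C) = C := set_actVK (act1 a) (actM a) g C.

Lemma E_compl C : E C -> E (~` C). Proof. exact: optimal_cutsC. Qed.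

Lemma E_nonempty C : E C -> C !=set0. Proof. exact: optimal_cuts_neq0. Qed.

Lemma E_nest C D : E C -> E D ->
  [\/ C `<=` D, C `<=` ~` D, ~` C `<=` D | D `<=` C].
Proof. by move=> eC eD; apply: nested_cases; apply: (optimal_cuts_nested Γ_connected eC eD). Qed.

Lemma E_fin x y : finite_set [set C | [/\ E C, C x & ~ C y]].
Proof.
apply: sub_finite_set (@finite_kcuts_separating _ k x y).
by move=> C [eC Cx nCy]; split=> //; apply: optimal_cuts_kcut.
Qed.

Lemma E_invariant g C : E C -> E (g • C). Proof. exact: optimal_cuts_act. Qed.

(** A coset of a vertex stabilizer. *)
Lemma transporter_finite u v : finite_set [set g | a g u = v].
Proof.
have [[g0 g0u]|no] := pselect (exists g, a g u = v); last first.
  by apply: (@sub_finite_set _ _ set0) => // g gu; case: no; exists g.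
apply: (@sub_finite_set _ _ ((fun h => g0 * h) @` stabilizer a u)).
  move=> g gu; exists (g0^-1 * g); last by rewrite mulVKg.
  by rewrite /stabilizer /= actM gu -g0u actK.
exact: finite_image.
Qed.

Lemma E_boundary C : E C -> finite_boundary C.
Proof. by move=> /(optimal_cuts_kcut Γ_connected)[]. Qed.

Lemma E_edge C : E C -> exists u v, [/\ adj u v, C u & ~ C v].
Proof.
move=> eC; have [x Cx] := E_nonempty eC; have [y nCy] := E_nonempty (E_compl eC).
by have [[u v] [/= ? ? ?]] := boundary_neq0 Γ_connected Cx nCy; exists u, v.
Qed.

(** Such elements move a vertex incident to the finite boundary of [C] to one
    incident to that of [D]. *)
Lemma cut_transporter_finite C D : E C -> E D -> finite_set [set g | g • C = D].
Proof.
move=> eC eD; have [u [v [uv Cu nCv]]] := E_edge eC.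
apply: (@sub_finite_set _ _ (\bigcup_(u' in fst @` boundary D) [set g | a g u = u'])).
  move=> g gC; exists (a g u) => //; exists (a g u, a g v) => //; rewrite -gC.
  by split; rewrite /= ?act_adj // act_in.
apply: bigcup_finite => [|u' _]; last exact: transporter_finite.
exact: finite_image (E_boundary eD).
Qed.

(** Every cut has an edge in its boundary, edges fall into finitely many orbits,
    and only finitely many of these cuts separate the ends of a given edge. *)
Lemma E_orbits : exists2 F : set (set Γ), finite_set F /\ F `<=` E &
  forall C, E C -> exists g C', F C' /\ C = g • C'.
Proof.
exists (\bigcup_(u in W) \bigcup_(v in [set v | adj u v]) [set C | [/\ E C, C u & ~ C v]]).
  split; last by move=> C [u _ [v _ []]].
  apply: bigcup_finite => // u _; apply: bigcup_finite; first exact: Γ_locally_finite.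
  by move=> v _; apply: E_fin.
move=> C eC; have [u [v [uv Cu nCv]]] := E_edge eC.
have [g [u' [Wu' ue]]] := W_orbits u.
exists g, (g^-1 • C); split; last by rewrite actsVK.
exists u' => //; exists (a g^-1 v); first by rewrite /= -(act_adj a g) actVK -ue.
split; [exact: E_invariant| |]; rewrite /set_act /= invgK.
  by rewrite -ue.
by rewrite actVK.
Qed.

(** Replace each representative by a translate lying in [S], if it has one. *)
Lemma subset_orbits (Z : Type) (actZ : G -> Z -> Z) (F S : set Z) (H : set G) :
  (forall g h z, actZ (g * h) z = actZ g (actZ h z)) -> (forall z, actZ 1 z = z) ->
  finite_set F -> (forall z, S z -> exists g f, F f /\ z = actZ g f) ->
  (forall g z, S z -> S (actZ g z) -> H g) ->
  exists2 F' : set Z, finite_set F' /\ F' `<=` S &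
    forall z, S z -> exists h f, [/\ H h, F' f & z = actZ h f].
Proof.
move=> actZM actZ1 fF SF SH.
have [[z0 Sz0]|noS] := pselect (S !=set0); last first.
  by exists set0 => [|z Sz]; [split|case: noS; exists z].
have /choice[p pP] f : exists z, (exists g, S (actZ g f)) -> S z /\ exists g, z = actZ g f.
  have [[g Sg]|] := pselect (exists g, S (actZ g f)); last by exists z0.
  by exists (actZ g f) => _; split=> //; exists g.
exists (p @` F `&` S); first by split=> [|z []//]; apply/finite_setIl/finite_image.
move=> z Sz; have [g [f [Ff zf]]] := SF z Sz.
have [|Sp [g' pg']] := pP f; first by exists g; rewrite -zf.
have zE : z = actZ (g * g'^-1) (p f).
  by rewrite pg' -actZM mulgVK.
exists (g * g'^-1), (p f); split=> //.
by apply: (SH _ (p f)); rewrite -?zE.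
Qed.

Let Or := orientation E x0.
Local Notation point := (pointing E).

(** An infinite stabilizer [H] of an orientation [O] acts, with finitely many
    orbits, on the infinite set [rim] of vertices next to the corresponding vertex
    of the tree, and this set is coarsely connected.  All but finitely many of its
    elements lie on the side chosen by [O] of any given optimal cut.  By bounded
    treewidth some set with at most [k] boundary edges splits the rim into two
    infinite parts; an optimal cut between ultrafilters concentrated on these two
    parts contradicts the choice made by [O]. *)
Section OrientationStabilizer.
Variable O : set (set Γ).
Hypothesis O_orient : Or O.

Let H : set G := [set g | family_act a g O = O].

Lemma H_mem h C : H h -> O (h • C) <-> O C.
Proof.
by move=> Hh; rewrite -{1}Hh /family_act /mkset actsK.
Qed.

Lemma H_V h : H h -> H h^-1.
Proof.
move=> Hh; rewrite /H /= -{1}Hh -(family_actM (actM a)) mulVg.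
exact: family_act1 (act1 a) _.
Qed.

Let OE C : O C -> E C. Proof. by case: O_orient => h _ _ _ _; apply: h. Qed.

(** The vertices of the graph placed at the vertex [O] of the tree. *)
Definition center : set Γ := [set x | point x = O].

Definition ends C : set Γ := fst @` boundary C `|` snd @` boundary C.

Definition rim : set Γ := center `|` \bigcup_(C in minimal_in O) ends C.

Lemma H_minimal h C : H h -> minimal_in O C -> minimal_in O (h • C).
Proof.
move=> Hh [OC minC]; split=> [|D OD DC]; first exact/H_mem.
have := minC (h^-1 • D); rewrite (H_mem D (H_V Hh)) => /(_ OD).
have DC' := set_act_sub (act := a) (g := h^-1) DC; rewrite actsK in DC'.
by move=> /(_ DC') <-; rewrite actsVK.
Qed.

Lemma H_center h x : H h -> center x -> center (a h x).
Proof.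
move=> Hh px; rewrite /center /=.
by rewrite -(family_act_pointing (act1 a) (actM a) E_invariant) px.
Qed.

Lemma ends_act g C x : ends C x -> ends (g • C) (a g x).
Proof.
rewrite /ends boundary_act => -[[[u v] uv /= <-]|[[u v] uv /= <-]]; [left|right].
  by exists (a g u, a g v) => //; exists (u, v).
by exists (a g u, a g v) => //; exists (u, v).
Qed.

Lemma H_rim h x : H h -> rim x -> rim (a h x).
Proof.
move=> Hh [cx|[C mC Cx]]; first by left; apply: H_center.
by right; exists (h • C); [apply: H_minimal|apply: ends_act].
Qed.

Lemma ends_finite C : E C -> finite_set (ends C).
Proof.
by move=> /E_boundary fC; rewrite finite_setU; split; apply: finite_image.
Qed.

Lemma ends_edge C u v : adj u v -> C u -> ~ C v -> ends C u /\ ends C v.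
Proof. by move=> uv Cu nCv; split; [left|right]; exists (u, v). Qed.

Lemma minimal_inj C D v : minimal_in O C -> minimal_in O D -> ~ C v -> ~ D v -> C = D.
Proof.
move=> [OC minC] [OD minD] nCv nDv; have [_ _ Ox Ou _] := O_orient.
have [CD|CD|CD|DC] := E_nest (OE OC) (OE OD).
- exact: minD.
- by case: (Ox D OD); apply: (Ou C) => //; apply/E_compl/OE.
- by case: nDv; apply: CD.
- by apply/esym; apply: minC.
Qed.

Lemma center_minimal C v : center v -> minimal_in O C -> C v.
Proof. by move=> <- [[]]. Qed.

Lemma not_center v : ~ center v -> exists2 C, minimal_in O C & ~ C v.
Proof.
move=> ncv; have [|C mC nCv] := @ex_minimal_in _ E x0 E_compl E_fin O O_orient v.
  by move=> e; apply: ncv.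
by exists C.
Qed.

(** Coarse connectedness of the rim. The vertices outside the center fall into
    the disjoint complements of the minimal elements of [O], and an edge leaving
    such a complement belongs to a boundary. Hence, if each of these complements
    is collapsed onto its boundary, a set that separates no two close points of
    the rim becomes a set without boundary, so it contains all of the rim or
    none of it. Closeness is tested in one finite set because there are finitely
    many orbits. *)
Lemma rim_connected : exists P Q : set Γ, [/\ finite_set P, finite_set Q,
  forall x, rim x -> exists h p, [/\ H h, P p & x = a h p] &
  forall D x y, rim x -> D x -> rim y -> ~ D y ->
    exists h p q, [/\ H h, Q p, Q q, D (a h p) & ~ D (a h q)]].
Proof.
have [F [fF FE] FC] := E_orbits.
have [C0 [fC0 C0m] C0P] : exists2 C0 : set (set Γ),
    finite_set C0 /\ C0 `<=` minimal_in O & forall C, minimal_in O C ->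
    exists h C', [/\ H h, C0 C' & C = h • C'].
  apply: (@subset_orbits _ (set_act a) F) => //.
  - exact: set_actM (actM a).
  - exact: set_act1 (act1 a).
  - by move=> C [/OE eC _]; apply: FC.
  - move=> g C mC mgC; rewrite /H /=.
    have eC : E C by case: mC => /OE.
    have e1 := minimal_in_start E_compl E_nonempty E_nest E_fin O_orient mgC.
    have e2 := minimal_in_start E_compl E_nonempty E_nest E_fin O_orient mC.
    rewrite -(family_act_start (act1 a) (actM a) E_invariant) -e2 in e1.
    exact: esym e1.
have [B0 [fB0 B0c] B0P] : exists2 B0 : set Γ,
    finite_set B0 /\ B0 `<=` center & forall x, center x ->
    exists h x', [/\ H h, B0 x' & x = a h x'].
  apply: (@subset_orbits _ a W) => //.
  - exact: actM.
  - exact: act1.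
  - move=> g x cx cgx; rewrite /H /= -{1}cx.
    by rewrite (family_act_pointing (act1 a) (actM a) E_invariant).
pose P := B0 `|` \bigcup_(C in C0) ends C.
pose N := \bigcup_(x in B0) [set y | adj x y].
have fP : finite_set P.
  rewrite finite_setU; split; first by [].
  by apply: bigcup_finite => // C /C0m[/OE eC _]; apply: ends_finite.
have fN : finite_set N by apply: bigcup_finite => // x _; apply: Γ_locally_finite.
exists P, (P `|` N); split; [by []|by rewrite finite_setU| |].
  move=> x [/B0P[h [x' [Hh B0x' ->]]]|[C /C0P[h [C' [Hh C0C' ->]]] Cx]].
    by exists h, x'; split=> //; left.
  exists h, (a h^-1 x); split=> //; last by rewrite actVK.
  right; exists C' => //; rewrite -(actsK h C'); exact: ends_act.
move=> D x y rx Dx ry nDy; apply: contrapT => nosep.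
have sep h p q : H h -> (P `|` N) p -> (P `|` N) q -> D (a h p) -> D (a h q).
  by move=> Hh Pp Pq Dp; apply: contrapT => nDq; apply: nosep; exists h, p, q.
have sep_ends C u v : minimal_in O C -> ends C u -> ends C v -> D u -> D v.
  move=> /C0P[h [C' [Hh C0C' ->]]] eu ev.
  have in_ends z : ends (h • C') z -> (P `|` N) (a h^-1 z).
    move=> ez; left; right; exists C' => //.
    by rewrite -(actsK h C'); apply: ends_act.
  have := sep h _ _ Hh (in_ends _ eu) (in_ends _ ev).
  by rewrite !actVK.
have sep_center u v : center u -> adj u v -> (D u <-> D v).
  move=> /B0P[h [u' [Hh B0u' ue]]] uv.
  have Pu : (P `|` N) u' by left; left.
  have Nv : (P `|` N) (a h^-1 v).
    by right; exists u' => //; rewrite /= -(act_adj a h) actVK -ue.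
  have := sep h _ _ Hh Pu Nv; have := sep h _ _ Hh Nv Pu.
  by rewrite actVK -ue.
(* [D] with every complement of a minimal element collapsed onto its boundary. *)
pose D' : set Γ := [set v | (center v /\ D v) \/
  exists C, [/\ minimal_in O C, ~ C v & ends C `<=` D]].
have D'c v : center v -> D' v -> D v.
  move=> cv [[]//|[C [mC nCv _]]].
  by case: nCv; apply: center_minimal.
have D'C C v : minimal_in O C -> ~ C v -> D' v -> ends C `<=` D.
  move=> mC nCv [[cv _]|[C' [mC' nC'v eC']]].
    by case: nCv; apply: center_minimal.
  by rewrite (minimal_inj mC mC' nCv nC'v).
have D'adj u v : adj u v -> D' u -> D' v.
  move=> uv D'u.
  have [cu|/not_center[C mC nCu]] := pselect (center u);
  have [cv|/not_center[C' mC' nC'v]] := pselect (center v).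
  - by left; split=> //; apply/(sep_center u v cu uv); apply: D'c.
  - right; exists C'; split=> // z Cz.
    have [eu ev] := ends_edge uv (center_minimal cu mC') nC'v.
    by apply: (sep_ends C' u) => //; apply: D'c.
  - have vu : adj v u by rewrite adj_sym.
    have [ev eu] := ends_edge vu (center_minimal cv mC) nCu.
    by left; split=> //; apply: (D'C C u).
  - have eCD := D'C C u mC nCu D'u.
    have [eCC|neC] := pselect (C = C'); first by right; exists C; split=> //; rewrite eCC.
    have Cv : C v by apply: contrapT => nCv; apply: neC; apply: minimal_inj nC'v.
    have C'u : C' u.
      by apply: contrapT => nC'u; apply: neC; apply: minimal_inj nC'u.
    have vu : adj v u by rewrite adj_sym.
    have [_ eu] := ends_edge vu Cv nCu.
    have [eu' _] := ends_edge uv C'u nC'v.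
    right; exists C'; split=> // z Cz.
    by apply: (sep_ends C' u) => //; apply: eCD.
have far C : minimal_in O C -> exists v, ~ C v.
  by move=> [/OE/E_compl/E_nonempty].
have [x' D'x'] : exists x', D' x'.
  case: rx => [cx|[C mC Cx]]; first by exists x; left.
  have [v nCv] := far C mC; exists v; right; exists C; split=> // z Cz.
  exact: (sep_ends C x).
have [y' nD'y'] : exists y', ~ D' y'.
  case: ry => [cy|[C mC Cy]]; first by exists y => /(D'c y cy).
  have [v nCv] := far C mC; exists v => /(D'C C v mC nCv) eCD.
  by apply: nDy; apply: eCD.
have [[u v] [/= uv D'u nD'v]] := boundary_neq0 Γ_connected D'x' nD'y'.
by apply: nD'v; apply: D'adj uv D'u.
Qed.

(** Only finitely many cuts in [O] fail to contain a given vertex, and the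
    translates of [C] by elements of [H] lie in [O]. *)
Lemma rim_side C : O C -> finite_set (rim `&` ~` C).
Proof.
move=> OC; have [P [_ [fP _ PH _]]] := rim_connected.
apply: (@sub_finite_set _ _ (\bigcup_(p in P) ((fun h => a h p) @`
  [set h | (O `\` point p) (h^-1 • C)]))).
  move=> x [/PH[h [p [Hh Pp ->]]] nC]; exists p => //; exists h => //.
  split; first exact/(H_mem _ (H_V Hh)).
  by case=> _; rewrite /set_act /= invgK.
apply: bigcup_finite => // p _; apply: finite_image.
have fS : finite_set (O `\` point p) by apply: orientation_finite E_fin _ O_orient p.
apply: (@sub_finite_set _ _ (\bigcup_(S in O `\` point p) [set h | h • S = C])).
  by move=> h hC; exists (h^-1 • C) => //=; rewrite actsVK.
apply: bigcup_finite => // S [OS _].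
by apply: cut_transporter_finite; apply: OE.
Qed.

Hypothesis H_infinite : infinite_set H.

Lemma rim_infinite : infinite_set rim.
Proof.
move=> fr; apply: H_infinite.
have [x rx] : rim !=set0.
  have [cx|/not_center[C mC _]] := pselect (center x0); first by exists x0; left.
  have [u [v [uv Cu nCv]]] : exists u v, [/\ adj u v, C u & ~ C v].
    by apply: E_edge; apply: OE; case: mC.
  by exists u; right; exists C => //; case: (ends_edge uv Cu nCv).
apply: (@sub_finite_set _ _ (\bigcup_(y in rim) [set g | a g x = y])).
  by move=> h Hh; exists (a h x) => //; apply: H_rim.
by apply: bigcup_finite => // y _; apply: transporter_finite.
Qed.

Hypothesis rim_unsplit : forall D, finite_boundary D -> cut_size D <= k ->
  finite_set (rim `&` D) \/ finite_set (rim `&` ~` D).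

(** By coarse connectedness, up to the action of [H] only finitely many such
    cuts split the rim. *)
Lemma kcut_rim_bound : exists N, forall D, kcut k D -> finite_set (rim `&` D) ->
  csize (rim `&` D) <= N.
Proof.
have [_ [Q [_ fQ _ sepQ]]] := rim_connected.
pose K := \bigcup_(p in Q) \bigcup_(q in Q) [set D | [/\ kcut k D, D p & ~ D q]].
have fK : finite_set K.
  apply: bigcup_finite => // p _; apply: bigcup_finite => // q _.
  exact: finite_kcuts_separating.
exists (\max_(D <- fset_set K) csize (rim `&` D)) => D kD fD.
have [[x [rx Dx]]|no] := pselect ((rim `&` D) !=set0); last first.
  rewrite (_ : rim `&` D = set0); first by rewrite /csize fset_set0.
  by apply/seteqP; split=> // x rDx; apply: no; exists x.
have [y ry nDy] : exists2 y, rim y & ~ D y.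
  apply: contrapT => all; apply: rim_infinite.
  apply: sub_finite_set fD => y ry; split=> //; apply: contrapT => nDy.
  by apply: all; exists y.
have [h [p [q [Hh Qp Qq Dp nDq]]]] := sepQ D x y rx Dx ry nDy.
have KD : K (h^-1 • D).
  exists p => //; exists q => //; split; first exact: kcut_act.
    by rewrite /set_act /= invgK.
  by rewrite /set_act /= invgK.
have sub : rim `&` D `<=` a h @` (rim `&` (h^-1 • D)).
  move=> z [rz Dz]; exists (a h^-1 z); last exact: actVK.
  by split; [apply: H_rim => //; apply: H_V|rewrite /set_act /= invgK actVK].
have fD' : finite_set (rim `&` (h^-1 • D)).
  apply: (@sub_finite_set _ _ (a h^-1 @` (rim `&` D))); last exact: finite_image.
  move=> z [rz]; rewrite /set_act /= invgK => Dz; exists (a h z); last exact: actK.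
  by split=> //; apply: H_rim.
apply: leq_trans (csize_le (finite_image _ fD') sub) _.
apply: leq_trans (csize_image _ fD') _.
apply: (@leq_bigmax_seq _ _ _ (fun D => csize (rim `&` D))) => //.
by rewrite in_fset_set // inE.
Qed.

(** Cutting a set, or its complement, into pieces without edges between them
    makes the boundary smaller. *)
Lemma rim_bound : exists N, forall D, finite_boundary D -> cut_size D <= k ->
  finite_set (rim `&` D) -> csize (rim `&` D) <= N.
Proof.
have [N NP] := kcut_rim_bound.
suff bound n D : finite_boundary D -> cut_size D < n -> cut_size D <= k ->
    finite_set (rim `&` D) -> csize (rim `&` D) <= 2 ^ n * N.
  by exists (2 ^ k.+1 * N)%N => D fD Dk; apply: bound.
elim: n D => // n IHn D fD; rewrite ltnS => Dn Dk frD.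
have [y nDy] : exists y, ~ D y.
  apply: contrapT => /forallNP all; apply: rim_infinite.
  by apply: sub_finite_set frD => z rz; split=> //; apply: contrapT; apply: all.
have [cD|/not_cohesive[D1 [D1D D10 DD1 Dadj]]] := pselect (cohesive D); last first.
  have D2D : D `\` D1 `<=` D by move=> ? [].
  have Dadj2 := split_sym Dadj.
  have [fD1 fD2] : finite_boundary D1 /\ finite_boundary (D `\` D1).
    by split; apply: sub_finite_set fD; apply: boundary_split.
  have c1 : cut_size D1 < cut_size D by apply: cut_size_split => //; exists y.
  have c2 : cut_size (D `\` D1) < cut_size D.
    apply: cut_size_split => //; last by exists y.
    by case: D10 => z Dz; exists z; split; [apply: D1D|case].
  have [fr1 fr2] : finite_set (rim `&` D1) /\ finite_set (rim `&` (D `\` D1)).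
    by split; apply: sub_finite_set frD; apply: setIS.
  have := leq_add (IHn D1 fD1 (leq_trans c1 Dn) (leq_trans (ltnW c1) Dk) fr1)
    (IHn _ fD2 (leq_trans c2 Dn) (leq_trans (ltnW c2) Dk) fr2).
  rewrite addnn -mul2n mulnA -expnS; apply: leq_trans.
  apply: leq_trans (csize_setU_le fr1 fr2); apply: csize_le; first by rewrite finite_setU.
  by move=> z [rz Dz]; have [D1z|nD1z] := pselect (D1 z); [left|right].
have leN : N <= 2 ^ n.+1 * N by rewrite leq_pmull // expn_gt0.
have le2 : 2 ^ n * N <= 2 ^ n.+1 * N by rewrite leq_mul2r leq_pexp2l // orbT.
have [cD'|/not_cohesive[R1 [R1D R10 DR1 Radj]]] := pselect (cohesive (~` D)).
  by apply: leq_trans leN; apply: NP.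
have [[z [rz Dz]]|no] := pselect ((rim `&` D) !=set0); last first.
  rewrite (_ : rim `&` D = set0); first by rewrite /csize fset_set0.
  by apply/seteqP; split=> // z rDz; apply: no; exists z.
have fD' := finite_boundaryC fD.
have nz : exists z, ~ (~` D) z by exists z; apply.
have small R : R `<=` ~` D -> finite_boundary R -> cut_size R < cut_size D ->
    finite_set (rim `&` ~` R) -> csize (rim `&` D) <= 2 ^ n.+1 * N.
  move=> RD fR cR fr; apply: leq_trans le2.
  apply: leq_trans (IHn (~` R) (finite_boundaryC fR) _ _ fr); rewrite ?cut_sizeC //.
  - by apply: csize_le => // u [ru Du]; split=> // /RD.
  - exact: leq_trans cR Dn.
  - exact: leq_trans (ltnW cR) Dk.
pose R2 := ~` D `\` R1; have R2D : R2 `<=` ~` D by move=> ? [].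
have Radj2 := split_sym Radj.
have [fR1 fR2] : finite_boundary R1 /\ finite_boundary R2.
  by split; apply: sub_finite_set fD'; apply: boundary_split.
have c1 : cut_size R1 < cut_size D.
  by rewrite -(cut_sizeC fD); apply: cut_size_split.
have c2 : cut_size R2 < cut_size D.
  rewrite -(cut_sizeC fD); apply: cut_size_split => //.
  by case: R10 => u Ru; exists u; split; [apply: R1D|case].
have [fr1|] := rim_unsplit fR1 (leq_trans (ltnW c1) Dk); last exact: small.
have [fr2|] := rim_unsplit fR2 (leq_trans (ltnW c2) Dk); last exact: small.
case: rim_infinite; apply: (@sub_finite_set _ _
  ((rim `&` D) `|` ((rim `&` R1) `|` (rim `&` R2)))); last by rewrite !finite_setU.
move=> u ru; have [Du|nDu] := pselect (D u); first by left.
by right; have [R1u|nR1u] := pselect (R1 u); [left|right].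
Qed.

End OrientationStabilizer.

Lemma orientation_stabilizer_finite O : Or O ->
  finite_set [set g | family_act a g O = O].
Proof.
move=> oO; apply: contrapT => iH; have ri := rim_infinite oO iH.
have [D [fD Dk rD rD']] : exists D, [/\ finite_boundary D, cut_size D <= k,
    infinite_set (rim O `&` D) & infinite_set (rim O `&` ~` D)].
  apply: contrapT => nosplit.
  have [|N NP] := rim_bound oO iH.
    move=> D fD Dk; apply: contrapT => /not_orP[? ?]; apply: nosplit.
    by exists D.
  by apply: nosplit; apply: (treewidth_split X_decomp X_width Γ_degree ri NP).
have [ξ Uξ ξP] := infinite_ultrafilter rD.
have [η Uη ηP] := infinite_ultrafilter rD'.
have ξD : ξ D by apply: ξP; apply: (@sub_finite_set _ _ set0) => // x [[_ ?]].
have ηD : η (~` D) by apply: ηP; apply: (@sub_finite_set _ _ set0) => // x [[_ ?]].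
have side C : O C -> ξ C /\ η C.
  move=> OC; have fC := rim_side oO OC.
  by split; [apply: ξP|apply: ηP]; apply: sub_finite_set fC => x [[rx _] nCx].
have [|C eC sC] := optimal_cut_exists (k := k) Uξ Uη fD Dk.
  by move=> [/(_ ξD) + _]; apply/(ultraC Uη).
have [_ Oe _ _ _] := oO.
have [/side[ξC ηC]|/side[ξC ηC]] := Oe C eC; first by apply: sC.
by move: ξC ηC => /(ultraC Uξ) nξC /(ultraC Uη) nηC; apply: sC; split.
Qed.

(** * The structure tree of the graph *)

Let tree := cut_tree x0 E_compl E_nonempty E_nest E_fin.
Let tree_act : tree_action G tree :=
  cut_tree_action x0 E_compl E_nonempty E_nest E_fin (act1 a) (actM a) E_invariant.

(** Fixing a midpoint means preserving a cut up to complement. *)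
Lemma tree_stabilizer_finite v : finite_set (vstab tree_act v).
Proof.
suff h : finite_set [set g | family_act a g (val v) = val v].
  by apply: sub_finite_set h => g gv; rewrite /= -{2}gv.
have [oO|[C eC ->]] := ctvertex_in v; first exact: orientation_stabilizer_finite.
apply: (@sub_finite_set _ _ ([set g | g • C = C] `|` [set g | g • C = ~` C])).
  move=> g; rewrite /= (family_act_mid (act1 a) (actM a) E_invariant) => gm.
  have [_ oC _ _ _] := start_orientation x0 E_compl E_nonempty E_nest E_fin eC.
  have egC : E (g • C) by apply: E_invariant.
  have [s|s] := oC _ egC.
    left; apply: contrapT => ne; have := start_mid s ne; rewrite -gm.
    by case.
  right; apply: contrapT => ne.
  have : mid E C (~` (g • C)).
    by apply: (start_mid s) => e; apply: ne; rewrite -[LHS]classical_sets.setCK e.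
  by rewrite -gm; case.
rewrite finite_setU; split; apply: cut_transporter_finite => //.
exact: E_compl.
Qed.

Lemma tree_edges_finite (D : fdomain tree_act) : finite_set [set e | drep D e = e].
Proof.
have [F [fF FE] FC] := E_orbits.
have fF' : finite_set ((fun e : tedge tree => val e) @^-1` F).
  by apply: finite_preimage => // e e' _ _ /val_inj.
apply: (@sub_finite_set _ _ (drep D @` ((fun e : tedge tree => val e) @^-1` F))).
  move=> e eq; have [g [C [FC' eC]]] := FC _ (ctedge_in e).
  pose f : tedge tree := exist _ C (mem_set (FE C FC')).
  exists f => //; rewrite -[RHS]eq -(drep_act D g f); congr (drep D _).
  by apply: val_inj; rewrite eC.
exact: finite_image.
Qed.

Lemma structure_tree : exists (Tr : rtree) (A : tree_action G Tr) (D : fdomain A),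
  finite_set [set e | drep D e = e] /\ forall v, finite_set (vstab A v).
Proof.
have [D] := ex_fdomain tree_act; exists tree, tree_act, D.
by split; [apply: tree_edges_finite|apply: tree_stabilizer_finite].
Qed.

End Stabilizers.

(** * Assembling the theorem *)

(** Every vertex but the root is an end of an edge. *)
Lemma finite_domain (G : groupType) (T : rtree) (A : tree_action G T) (D : fdomain A) :
  finite_set [set e | drep D e = e] -> finite_set (dS D).
Proof.
move=> fQ; set Q := [set e | _] in fQ.
apply: (@sub_finite_set _ _ ([set root] `|`
  ((fun e => dvrep D (org e)) @` Q `|` (fun e => dvrep D (trm e)) @` Q))).
  move=> v Sv; have [->|/parent_exists[e [u [vu _]]]] := pselect (v = root); first by left.
  have Qe : Q (drep D e) by rewrite /Q /= drepK.
  right; case: vu => [[ev _]|[_ ev]]; [left|right]; exists (drep D e) => //.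
    by rewrite org_drep ev !dvrep_id.
  by rewrite dvrep_trm ev dvrep_id.
by rewrite !finite_setU; split; [apply: finite_set1|split; apply: finite_image].
Qed.

Lemma finite_vertex_orbits (G : groupType) (Γ : sgraph) (a : graph_action G Γ) :
  finite_set [set vertex_orbit a v | v in [set: Γ]] ->
  exists2 W : set Γ, finite_set W & forall v, exists g w, W w /\ v = a g w.
Proof.
move=> fO; have [[v0 _]|noΓ] := pselect ([set: Γ] !=set0); last first.
  by exists set0 => // v; case: noΓ; exists v.
have /choice[r rP] (S : set Γ) : exists v, S !=set0 -> S v.
  by have [[v Sv]|] := pselect (S !=set0); [exists v|exists v0].
exists (r @` [set vertex_orbit a v | v in [set: Γ]]); first exact: finite_image.
move=> v; have [|g _ gv] := rP (vertex_orbit a v).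
  by exists v; exists 1 => //; apply: act1.
exists g^-1, (r (vertex_orbit a v)); split; last by rewrite -gv actK.
by exists (vertex_orbit a v) => //; exists v.
Qed.

Lemma bounded_degree (G : groupType) (Γ : sgraph) (a : graph_action G Γ) (W : set Γ) :
  locally_finite Γ -> finite_set W -> (forall v, exists g w, W w /\ v = a g w) ->
  exists d, forall v : Γ, finite_set [set u | adj v u] /\ csize [set u | adj v u] <= d.
Proof.
move=> lf fW WP; pose N v := csize [set u : Γ | adj v u].
exists (\max_(v <- fset_set W) N v) => v; split; first exact: lf.
have [g [w [Ww ->]]] := WP v; apply: (@leq_trans (N w)); last first.
  by apply: (@leq_bigmax_seq _ _ _ N) => //; rewrite in_fset_set // inE.
apply: leq_trans (csize_image (a g) (lf w)); apply: csize_le.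
  exact/finite_image/lf.
move=> u gu; exists (a g^-1 u); last exact: actVK.
by rewrite /= -(act_adj a g) actVK.
Qed.

Theorem corollary6p27 (G : groupType) (Γ : sgraph) (a : graph_action G Γ)
    (Γ_nonempty : [set: Γ] !=set0)
    (Γ_connected : connected_graph Γ)
    (Γ_locally_finite : locally_finite Γ)
    (Γ_treewidth : finite_treewidth Γ)
    (quotient_finite : finite_quotient_graph a)
    (stabilizers_finite : forall v : Γ, finite_set (stabilizer a v)) :
  (exists Y : graph_of_groups,
     [/\ finite_mgraph Y,
         forall P : Y, finite_set [set: vgroup P] &
         is_fundamental_group Y G]) /\
  virtually_free G.
Proof.
have [x0 _] := Γ_nonempty.
have [T [X [X_decomp [w X_width]]]] := Γ_treewidth.
have [W W_finite W_orbits] := finite_vertex_orbits quotient_finite.1.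
have [d Γ_degree] := bounded_degree Γ_locally_finite W_finite W_orbits.
have [Tr [A [D [D_edges A_stab]]]] := structure_tree Γ_connected Γ_locally_finite
  W_finite W_orbits stabilizers_finite X_decomp X_width Γ_degree x0.
have D_vertices := finite_domain D_edges.
split; last exact: tree_virtually_free D_vertices D_edges A_stab.
exists (quotient_gog D); split.
- exact: quotient_mgraph_finite.
- exact: quotient_groups_finite.
- exact: quotient_gog_pi1.
Qed.
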